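(* The map $M:BV(\mathbb{Z})\to BV(\mathbb{Z})$, $f\mapsto Mf$, where $M$ is the discrete centered Hardy--Littlewood maximal operator, is continuous with respect to the norm $\|\cdot\|_{BV(\mathbb{Z})}$.
   Context: For $f:\mathbb{Z}\to\mathbb{R}$, the discrete derivative is $f'(n)=f(n+1)-f(n)$ and the total variation is $\mathrm{Var}(f)=\|f'\|_{\ell^1(\mathbb{Z})}=\sum_{n\in\mathbb{Z}}|f(n+1)-f(n)|$. $BV(\mathbb{Z})$ is the space of functions $f:\mathbb{Z}\to\mathbb{R}$ with $\mathrm{Var}(f)<\infty$, a Banach space with the norm $\|f\|_{BV(\mathbb{Z})}=|f(-\infty)|+\mathrm{Var}(f)$, where $f(-\infty)=\lim_{n\to-\infty}f(n)$. The discrete centered Hardy--Littlewood maximal operator is $$Mf(n)=\sup_{r\ge 0,\ r\in\mathbb{Z}}\frac{1}{2r+1}\sum_{k=-r}^{r}|f(n+k)|,\qquad n\in\mathbb{Z}.$$ It is known that $M$ maps $BV(\mathbb{Z})$ into $BV(\mathbb{Z})$. *)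

(* Defs.v *)
From HB Require Import structures.
From mathcomp Require Import all_boot all_order all_algebra.
From mathcomp Require Import all_classical all_reals all_analysis.

Set Implicit Arguments.
Unset Strict Implicit.
Unset Printing Implicit Defensive.
Import Order.TTheory GRing.Theory Num.Theory.
Import numFieldNormedType.Exports.
Local Open Scope classical_set_scope.
Local Open Scope ring_scope.

Definition dderiv (R : realType) (f : int -> R) (n : int) : R := f (n + 1) - f n.

(* The unordered sum of a nonnegative family over int; it may be +oo. *)
Definition Var (R : realType) (f : int -> R) : \bar R :=
  \esum_(n in [set: int]) `|dderiv f n|%:E.

Definition lim_ninfty (R : realType) (f : int -> R) : R :=
  limn (fun k : nat => f (- k%:Z)).

Definition bounded_variation (R : realType) : {pred int -> R} :=
  [pred f | `[< (Var f < +oo)%E >]].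
Arguments bounded_variation {R}.

(* The index k of the sum over [-r, r] is shifted to range over [0, 2r]. The
   real supremum is meaningful only for bounded f, hence for f in BV(Z). *)
Definition centered_maximal (R : realType) (f : int -> R) (n : int) : R :=
  sup [set (2 * r + 1)%N%:R^-1 * \sum_(0 <= k < (2 * r + 1)%N) `|f (n + (k%:Z - r%:Z))|
      | r in [set: nat]].

Section BV_lemmas.
Variable R : realType.
Implicit Types (f g : int -> R).

Lemma Var_ge0 f : (0 <= Var f)%E.
Proof. by apply: esum_ge0 => n _; rewrite lee_fin. Qed.

Lemma Var_ge f (A : set int) : finite_set A ->
  (\sum_(n \in A) `|dderiv f n|%:E <= Var f)%E.
Proof. by move=> finA; apply: esum_ge; exists A. Qed.

Lemma Var0 : Var (0 : int -> R) = 0%E.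
Proof. by apply: esum1 => n _; rewrite /dderiv subrr normr0. Qed.

Lemma Var_leD f g : (Var (f + g)%R <= Var f + Var g)%E.
Proof.
rewrite -esumD; [|by move=> n _; rewrite lee_fin..].
apply: le_esum => n _; rewrite -EFinD lee_fin.
by rewrite /dderiv [in X in (X <= _)%R]opprD addrACA ler_normD.
Qed.

Lemma Var_leZ (a : R) f : (Var (a *: f)%R <= `|a|%:E * Var f)%E.
Proof.
rewrite /Var ge_ereal_sup => //= _ [X [finX XT]] <-.
apply: (@le_trans _ _ (`|a|%:E * \sum_(n \in X) `|dderiv f n|%:E)%E).
  rewrite ge0_mule_fsumr; last by move=> n; rewrite lee_fin.
  apply: lee_fsum => // n _.
  by rewrite -EFinM lee_fin -normrM /dderiv mulrBr.
by rewrite lee_wpmul2l ?Var_ge// lee_fin.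
Qed.

Lemma VarZ (a : R) f : Var (a *: f) = (`|a|%:E * Var f)%E.
Proof.
have [->|a0] := eqVneq a 0; first by rewrite scale0r Var0 normr0 mul0e.
apply/eqP; rewrite eq_le Var_leZ /=.
have := Var_leZ a^-1 (a *: f); rewrite scalerA mulVf// scale1r => h.
apply: (@le_trans _ _ (`|a|%:E * (`|a^-1|%:E * Var (a *: f)%R))%E).
  by rewrite lee_wpmul2l// lee_fin.
by rewrite muleA -EFinM -normrM mulfV// normr1 mul1e.
Qed.

Lemma bounded_variation_submod_closed :
  submod_closed (@bounded_variation R).
Proof.
split; first by apply/asboolP; rewrite Var0 ltry.
move=> a f g /asboolP fV /asboolP gV; apply/asboolP.
apply: (le_lt_trans (Var_leD _ _)); rewrite VarZ lte_add_pinfty//.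
by rewrite lte_mul_pinfty// lee_fin.
Qed.

HB.instance Definition _ := GRing.isSubmodClosed.Build _ _ (@bounded_variation R)
  bounded_variation_submod_closed.

Lemma is_cvg_ninfty f : f \in bounded_variation ->
  cvgn (fun k : nat => f (- k%:Z)).
Proof.
move=> /asboolP fV; pose u := fun k : nat => f (- k%:Z).
rewrite -/u.
have -> : u = (fun k => u 0%N + series (telescope u) k).
  by apply/funext => k; rewrite -eq_sum_telescope.
apply: is_cvgD; first exact: is_cvg_cst.
apply: normed_cvg.
apply: nondecreasing_is_cvgn.
  apply/nondecreasing_seqP => n; rewrite [leRHS]seriesSr.
  by rewrite lerDl /=.
exists (fine (Var f)) => _ [k _ <-].
rewrite -lee_fin fineK; last by rewrite ge0_fin_numE// Var_ge0.
pose e := fun i : nat => - (i.+1)%:Z : int.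
apply: le_trans (Var_ge f (finite_image e (finite_II k))).
rewrite /= /series /= big_mkord -sumEFin fsbig_image; last first.
  by move=> i j _ _ /oppr_inj [].
rewrite -fsbig_ord.
apply: lee_sum => i _ /=; rewrite lee_fin /telescope /= /dderiv /u /e.
rewrite distrC.
by rewrite -[in X in f (X + 1)]addn1 PoszD opprD subrK.
Qed.

Lemma lim_ninftyD f g : f \in bounded_variation -> g \in bounded_variation ->
  lim_ninfty (f + g) = lim_ninfty f + lim_ninfty g.
Proof. by move=> fV gV; apply: limD; exact: is_cvg_ninfty. Qed.

Lemma lim_ninftyZ (a : R) f : f \in bounded_variation ->
  lim_ninfty (a *: f) = a * lim_ninfty f.
Proof. by move=> fV; apply: limZl_tmp; exact: is_cvg_ninfty. Qed.

Lemma Var_eq0 f : Var f = 0%E -> forall n, f n = f 0.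
Proof.
move=> V0.
have f1 n : f (n + 1) = f n.
  have := Var_ge f (finite_set1 n); rewrite fsbig_set1 V0 lee_fin.
  by rewrite normr_le0 subr_eq0 => /eqP.
elim=> [//|n <-|n <-]; first by rewrite -addn1 PoszD f1.
by rewrite -f1 -addn1 PoszD opprD addrNK.
Qed.

End BV_lemmas.

Record BV (R : realType) := MkBV {
  BV_fun :> int -> R;
  BV_prop : BV_fun \in bounded_variation }.

Section BV_normed.
Variable R : realType.

HB.instance Definition _ := [isSub for @BV_fun R].
HB.instance Definition _ := [Choice of BV R by <:].
HB.instance Definition _ := [SubChoice_isSubLmodule of BV R by <:].

Definition BV_norm (f : BV R) : R := `|lim_ninfty f| + fine (Var f).

Lemma Var_fin_num (f : BV R) : Var f \is a fin_num.
Proof. by case: f => f /= /asboolP; rewrite ge0_fin_numE// Var_ge0. Qed.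

Lemma BV_normD (f g : BV R) : BV_norm (f + g) <= BV_norm f + BV_norm g.
Proof.
rewrite /BV_norm addrACA lerD//.
  by rewrite [BV_fun _]/(BV_fun f + BV_fun g) lim_ninftyD ?BV_prop// ler_normD.
rewrite -lee_fin EFinD !fineK ?Var_fin_num//; exact: Var_leD.
Qed.

Lemma BV_normZ (a : R) (f : BV R) : BV_norm (a *: f) = `|a| * BV_norm f.
Proof.
rewrite /BV_norm [BV_fun _]/(a *: BV_fun f) lim_ninftyZ ?BV_prop// VarZ.
by rewrite fineM ?Var_fin_num// normrM mulrDr.
Qed.

Lemma BV_norm_eq0 (f : BV R) : BV_norm f = 0 -> f = 0.
Proof.
move=> /eqP; rewrite paddr_eq0 ?fine_ge0 ?Var_ge0// normr_eq0.
move=> /andP[/eqP l0]; rewrite fine_eq0 ?Var_fin_num// => /eqP /Var_eq0 fc.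
have lE : lim_ninfty f = f 0.
  rewrite /lim_ninfty (_ : (fun k : nat => f (- k%:Z)) = fun=> f 0).
    exact: lim_cst.
  by apply/funext => k; rewrite fc.
by apply/val_inj/funext => n; rewrite [LHS]fc -lE.
Qed.

HB.instance Definition _ := Lmodule_isNormed.Build R (BV R)
  BV_normD BV_normZ BV_norm_eq0.

Lemma BV_normE (f : BV R) : `|f| = `|lim_ninfty f| + fine (Var f).
Proof. by []. Qed.

End BV_normed.

(* Main.v *)
Require Import Defs.
From HB Require Import structures.
From mathcomp Require Import all_boot all_order all_algebra.
From mathcomp Require Import all_classical all_reals all_analysis.
From mathcomp Require Import measurable_realfun ring lra zify.
Import Order.TTheory GRing.Theory Num.Theory.
Import numFieldNormedType.Exports.
Local Open Scope classical_set_scope.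
Local Open Scope ring_scope.

(** The operator is a contraction for the supremum norm, and the supremum norm
is at most the BV norm.  Hence, when h tends to f, the variation of Mf - Mh
over any fixed finite window tends to 0, and so does its limit at minus
infinity.  What is left is to bound the variation of Mh far from the origin,
uniformly for h near f ([maximal_outer_var]); with the cut at distance 1 from
the origin, the same bound shows that M preserves bounded variation.

For this bound replace f by |f| and write G for Mf.  Up to a boundary term the
variation of G is twice the sum of its descents d = G n - G (n + 1) > 0, so
ascents need no separate study.  At a descent the supremum is attained, at a
radius w say ([maximal_attained]).  Comparing the ball of radius w at n with
the balls of radii w - 1 and w + 1 at n + 1 shows that f exceeds G n by about
d w at the left end of the ball, and is below G n by as much just beyond its
right end ([shrunk_ball_high], [enlarged_ball_low]).

A descent is called two-sided if f also takes a value at most G n somewhere to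
the left of the ball, at distance O(w).  The other descents are harmless
([one_sided_descent_sum]): at each level u in [G (n + 1), G n), the component
of the set G > u that ends at n contains a point where f > u, so f crosses the
level u inside this component, and distinct components are disjoint.

At a two-sided descent f has a bump of width about w: low, high, low.  Group
these descents according to the dyadic size l of w and to an interval of
length l that contains n.  Let [two_sided_osc f r x] be the measure of the set
of levels that f crosses both to the left and to the right of x within
distance r.  Then, with r = 10 l, the descents of a group have sum at most
34 / l times the sum of [two_sided_osc f r x] over a window of length O(l)
([class_descent_sum]).  Indeed the two-sided oscillation controls the mean
deviation of f from G n on the ball, so that all values G n of the group
nearly agree with a common value; and since the two ends of the ball of n add
up to 2 n, if many n of the group have a large descent then either the left
ends or the right ends of their balls spread out, and what lies between the
extreme ones is enclosed by crossings of a common level.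

It remains to add up the groups ([edges_within_sum]).  At a fixed level, a
point enclosed at scale l lies in a gap, of length g = O(l), between two
consecutive crossings.  Such a gap contributes g / l at each scale l >= c g, in
total O(1), so the sum over groups is at most a constant times the number of
crossings; integrating over the levels gives a multiple of the variation of f.
If only descents at n >= K are counted, a gap inside [c1, c2) with c2 < K can
contribute only at scales l >= c (K - c2), which gives the small factor
(c2 - c1) / (K - c2) and makes the tail of the variation of G small as soon as
the tail of the variation of f is. *)

Set Implicit Arguments.
Unset Strict Implicit.
Unset Printing Implicit Defensive.

(** * Integration over levels *)

Section LevelIntegrals.
Variable R : realType.

(** Used as a layer-cake principle: a comparison between two finite sums of
lengths of intervals follows from the comparison, at each level, of the numbers
of intervals that contain this level. *)
Definition level_integral (h : R -> R) (v : R) :=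
  [/\ measurable_fun setT h, forall t, 0 <= h t &
      (\int[lebesgue_measure]_t (h t)%:E = v%:E)%E].

Lemma level_integral_le h1 v1 h2 v2 :
  level_integral h1 v1 -> level_integral h2 v2 ->
  (forall t, h1 t <= h2 t) -> v1 <= v2.
Proof.
move=> [m1 p1 i1] [m2 p2 i2] h12; rewrite -lee_fin -i1 -i2.
apply: ge0_le_integral => //; first by move=> x _; rewrite lee_fin.
- exact/measurable_EFinP.
- exact/measurable_EFinP.
- by move=> x _; rewrite lee_fin.
Qed.

Lemma level_integralD h1 v1 h2 v2 :
  level_integral h1 v1 -> level_integral h2 v2 ->
  level_integral (fun t => h1 t + h2 t) (v1 + v2).
Proof.
move=> [m1 p1 i1] [m2 p2 i2]; split.
- exact: measurable_funD.
- by move=> t; rewrite addr_ge0.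
- under eq_integral do rewrite EFinD.
  rewrite ge0_integralD//; first by rewrite i1 i2.
  + by move=> x _; rewrite lee_fin.
  + exact/measurable_EFinP.
  + by move=> x _; rewrite lee_fin.
  + exact/measurable_EFinP.
Qed.

Lemma level_integralZ c h v : 0 <= c -> level_integral h v ->
  level_integral (fun t => c * h t) (c * v).
Proof.
move=> c0 [m p i]; split.
- exact: measurable_funM.
- by move=> t; rewrite mulr_ge0.
- under eq_integral do rewrite EFinM.
  rewrite ge0_integralZl//; first by rewrite i.
  + exact/measurable_EFinP.
  + by move=> x _; rewrite lee_fin.
Qed.

Lemma level_integral0 : level_integral (fun=> 0) 0.
Proof. by split=> //; rewrite integral0_eq. Qed.

Lemma level_integral_sum I (r : seq I) (P : pred I) h v :
  (forall i, P i -> level_integral (h i) (v i)) ->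
  level_integral (fun t => \sum_(i <- r | P i) h i t) (\sum_(i <- r | P i) v i).
Proof.
move=> H; elim: r => [|i r IH].
  rewrite big_nil; under eq_fun do rewrite big_nil; exact: level_integral0.
rewrite big_cons; under eq_fun do rewrite big_cons.
case: ifP => [Pi|//]; exact: level_integralD (H i Pi) IH.
Qed.

Lemma level_integral_itv b0 b1 (a b : R) :
  level_integral (fun t => (t \in Interval (BSide b0 a) (BSide b1 b))%:R)
    (Num.max 0 (b - a)).
Proof.
have E : (fun t => (t \in Interval (BSide b0 a) (BSide b1 b))%:R) =
    \1_([set` Interval (BSide b0 a) (BSide b1 b)]) :> (R -> R).
  by apply/funext => t; rewrite indicE mem_setE.
rewrite E; split => //.
rewrite integral_indic// setIT.
transitivity (if (a%:E < b%:E)%E then (b%:E - a%:E)%E else 0%E).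
  exact: (lebesgue_measure_itv (Interval (BSide b0 a) (BSide b1 b))).
rewrite lte_fin.
case: ltP => ab; first by rewrite max_r ?subr_ge0 ?ltW.
by rewrite max_l ?subr_le0.
Qed.

End LevelIntegrals.

(** * Averages and counting on intervals *)

Section IntervalSums.
Variable R : realType.
Implicit Types (f h : nat -> R) (P Q : pred nat).

Lemma exists_le_average f (a b : nat) (c : R) : (a < b)%N ->
  \sum_(a <= x < b) f x <= (b - a)%:R * c ->
  exists x, [/\ (a <= x)%N, (x < b)%N & f x <= c].
Proof.
move=> ab le_c; apply: contrapT => none.
suff: (b - a)%:R * c < \sum_(a <= x < b) f x by rewrite ltNge le_c.
rewrite mulr_natl -sumr_const_nat.
apply: ltr_sum_nat => // x /andP[ax xb].
by rewrite ltNge; apply/negP => fx; apply: none; exists x.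
Qed.

Lemma exists_ge_average f (a b : nat) (c : R) : (a < b)%N ->
  (b - a)%:R * c <= \sum_(a <= x < b) f x ->
  exists x, [/\ (a <= x)%N, (x < b)%N & c <= f x].
Proof.
move=> ab ge_c.
have [|x [ax xb]] := @exists_le_average (fun x => - f x) a b (- c) ab.
  by rewrite sumrN mulrN lerN2.
by rewrite lerN2 => cx; exists x.
Qed.

Lemma ler_sum_widen h P (a b T : nat) : (forall x, 0 <= h x) -> (b <= T)%N ->
  (forall x, (a <= x)%N -> (x < b)%N -> P x) ->
  \sum_(a <= x < b) h x <= \sum_(0 <= x < T | P x) h x.
Proof.
move=> h0 bT inP.
rewrite (big_nat_widenl a 0%N)// (big_nat_widen _ _ T)//=.
rewrite big_mkcond [leRHS]big_mkcond/=; apply: ler_sum => x _.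
case: ifP => [/andP[ax xb]|_]; first by rewrite inP.
by case: ifP.
Qed.

Lemma count_ge P Q (a b T : nat) : (b <= T)%N ->
  (forall x, (a <= x)%N -> (x < b)%N -> P x /\ Q x) ->
  (b - a)%:R <= \sum_(0 <= x < T | P x) (Q x)%:R :> R.
Proof.
move=> bT inPQ.
have -> : (b - a)%:R = \sum_(a <= x < b) (Q x)%:R :> R.
  rewrite -sumr_const_nat big_nat [RHS]big_nat.
  by apply: eq_bigr => x /andP[ax xb]; have [_ ->] := inPQ x ax xb.
by apply: ler_sum_widen => // x ax xb; have [] := inPQ x ax xb.
Qed.

Lemma count_le P Q (a b T : nat) :
  (forall x, P x -> Q x -> (a <= x < b)%N) ->
  \sum_(0 <= x < T | P x) (Q x)%:R <= (b - a)%:R :> R.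
Proof.
move=> inab.
have -> : (b - a)%:R = \sum_(a <= x < b) 1 :> R by rewrite sumr_const_nat.
apply: (@le_trans _ _ (\sum_(0 <= x < maxn T b | (a <= x < b)%N) 1)).
  rewrite (big_nat_widen _ _ (maxn T b)) ?leq_maxl//.
  rewrite big_mkcond [leRHS]big_mkcond/=; apply: ler_sum => x _.
  case: ifP => [/andP[Px _]|_]; last by case: ifP.
  by case: (boolP (Q x)) => [Qx|_]; [rewrite inab|case: ifP].
rewrite (big_nat_widenl a 0%N)// (big_nat_widen _ _ (maxn T b)) ?leq_maxr//=.
Qed.

End IntervalSums.

(** * Two-sided oscillation *)

Section TwoSidedExtrema.
Variable R : realType.
Implicit Types (h f : nat -> R).

Definition window_max h (r : nat) : R := \big[Num.max/h 0%N]_(i < r.+1) h i.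
Definition window_min h (r : nat) : R := \big[Num.min/h 0%N]_(i < r.+1) h i.

Lemma window_max_gt h r c :
  c < window_max h r <-> exists2 i, (i <= r)%N & c < h i.
Proof.
split=> [/bigmax_gtP[c0|[i _ ci]]|[i ir ci]].
- by exists 0%N.
- by exists i; rewrite ?leq_ord.
- by apply/bigmax_gtP; right; exists (Ordinal (ir : i < r.+1)%N).
Qed.

Lemma window_min_le h r c :
  window_min h r <= c <-> exists2 i, (i <= r)%N & h i <= c.
Proof.
split=> [/bigmin_leP[c0|[i _ ci]]|[i ir ci]].
- by exists 0%N.
- by exists i; rewrite ?leq_ord.
- by apply/bigmin_leP; right; exists (Ordinal (ir : i < r.+1)%N).
Qed.

Definition two_sided_max f r x : R :=
  Num.min (window_max (fun i => f (x + i)%N) r)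
          (window_max (fun i => f (x - i)%N) r).

Definition two_sided_min f r x : R :=
  Num.max (window_min (fun i => f (x + i)%N) r)
          (window_min (fun i => f (x - i)%N) r).

(** The measure of the set of levels u with [enclosed f r u x], that is, of the
levels crossed by f both to the left and to the right of x within distance r.
It vanishes where f is monotone at scale r.  Near 0, [x - i] is truncated,
which only repeats the value of f at 0. *)
Definition two_sided_osc f r x : R :=
  Num.max 0 (two_sided_max f r x - two_sided_min f r x).

Lemma two_sided_max_gt f r x c : c < two_sided_max f r x <->
  (exists2 i, (i <= r)%N & c < f (x + i)%N) /\
  (exists2 i, (i <= r)%N & c < f (x - i)%N).
Proof.
by rewrite /two_sided_max lt_min; split=> [/andP[]|[]] /window_max_gt ? /window_max_gt ?;
  [|apply/andP].
Qed.

Lemma two_sided_min_le f r x c : two_sided_min f r x <= c <->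
  (exists2 i, (i <= r)%N & f (x + i)%N <= c) /\
  (exists2 i, (i <= r)%N & f (x - i)%N <= c).
Proof.
by rewrite /two_sided_min ge_max; split=> [/andP[]|[]] /window_min_le ? /window_min_le ?;
  [|apply/andP].
Qed.

Lemma two_sided_osc_ge0 f r x : 0 <= two_sided_osc f r x.
Proof. by rewrite /two_sided_osc le_max lexx. Qed.

Lemma two_sided_max_ge f r x : f x <= two_sided_max f r x.
Proof.
rewrite leNgt; apply/negP => lt_fx.
have : two_sided_max f r x < two_sided_max f r x.
  by apply/two_sided_max_gt; split; exists 0%N; rewrite ?addn0 ?subn0.
by rewrite ltxx.
Qed.

(** A value of f between two positions where f is at most c: all levels between
c and f x are crossed on both sides of x. *)
Lemma positive_part_le_osc f r x s t c : (s <= x <= t)%N ->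
  (x <= s + r)%N -> (t <= x + r)%N -> f s <= c -> f t <= c ->
  Num.max 0 (f x - c) <= two_sided_osc f r x.
Proof.
move=> /andP[sx xt] xs tx fs ft.
rewrite ge_max two_sided_osc_ge0 /two_sided_osc le_max; apply/orP; right.
apply: lerB; first exact: two_sided_max_ge.
apply/two_sided_min_le; split.
  by exists (t - x)%N; rewrite ?leq_subLR// subnKC.
by exists (x - s)%N; rewrite ?leq_subLR// subKn.
Qed.

Definition enclosed f r (u : R) (x : nat) : bool :=
  (two_sided_min f r x <= u) && (u < two_sided_max f r x).

Lemma enclosed_between f r u x (xa xb ya yb : nat) :
  (xa <= x <= xb)%N -> (ya <= x <= yb)%N -> (x <= minn xa ya + r)%N ->
  (maxn xb yb <= x + r)%N ->
  f xa <= u -> f xb <= u -> u < f ya -> u < f yb -> enclosed f r u x.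
Proof.
move=> /andP[ax xb'] /andP[ay yb']; rewrite addn_minl leq_min geq_max.
move=> /andP[e1 e2] /andP[e3 e4] f1 f2 f3 f4.
apply/andP; split.
  apply/two_sided_min_le; split.
    by exists (xb - x)%N; rewrite ?leq_subLR// subnKC.
  by exists (x - xa)%N; rewrite ?leq_subLR// subKn.
apply/two_sided_max_gt; split.
  by exists (yb - x)%N; rewrite ?leq_subLR// subnKC.
by exists (x - ya)%N; rewrite ?leq_subLR// subKn.
Qed.

End TwoSidedExtrema.

(** * Two-sided descents of one scale and place *)

(** The descents of a group: P selects positions n in a cell of length l, with
radii between l and 2 l, A n stands for the maximal function at n and d n for
its descent.  The three existential hypotheses are the bump of f: low to the
left of the ball, high at its left end, low beyond its right end. *)
Section ScaleClass.
Variables (R : realType) (f A d : nat -> R) (om : nat -> nat) (P : pred nat).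
Variables (T l c : nat).
Hypothesis l_gt0 : (0 < l)%N.
Hypothesis T_large : (c + 3 * l < T)%N.
Hypothesis om_scale : forall n, P n -> (l <= om n < 2 * l)%N.
Hypothesis P_cell : forall n, P n -> (c <= n < c + l)%N.
Hypothesis om_le : forall n, P n -> (om n <= n)%N.
Hypothesis avg_A : forall n, P n ->
  \sum_(n - om n <= x < n + om n + 1) f x = (2 * om n + 1)%:R * A n.
Hypothesis low_left : forall n, P n ->
  exists s, [/\ (n <= s + 3 * om n)%N, (s + om n < n)%N & f s <= A n].
Hypothesis high_left : forall n, P n ->
  exists x, [/\ (n <= x + om n)%N, (x + om n <= n.+1)%N &
    A n + d n * (l%:R / 2) <= f x].
Hypothesis low_right : forall n, P n ->
  exists t, [/\ (n + om n < t)%N, (t <= n + om n + 2)%N &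
    f t <= A n - d n * (l%:R / 2)].
Hypothesis d_ge0 : forall n, P n -> 0 <= d n.

Let r := (10 * l)%N.
Let W (x : nat) := (c <= x + 2 * l)%N && (x <= c + 3 * l)%N.
Let Lam : R := \sum_(0 <= x < T | W x) two_sided_osc f r x.

(** Both sides of the ball carry a point where f is at most A n, so each value
of f above A n on the ball is paid by the two-sided oscillation. *)
Lemma class_positive_part n : P n ->
  \sum_(n - om n <= x < n + om n + 1) Num.max 0 (f x - A n) <= Lam.
Proof.
move=> Pn; have := om_scale Pn; have := P_cell Pn; have := om_le Pn.
have [s [s1 s2 fs]] := low_left Pn.
have [t [t1 t2 ft]] := low_right Pn.
have {}ft : f t <= A n.
  apply: (le_trans ft); rewrite gerBl mulr_ge0 ?d_ge0//.
move=> h1 h2 h3.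
have -> : \sum_(n - om n <= x < n + om n + 1) Num.max 0 (f x - A n) =
    \sum_(n - om n <= x < n + om n + 1)
      Num.max 0 (f x - A n) *+ ((n - om n <= x) && (x < n + om n + 1))%N.
  by rewrite big_nat [RHS]big_nat; apply: eq_bigr => x ->.
apply: (@le_trans _ _ (\sum_(n - om n <= x < n + om n + 1) two_sided_osc f r x)).
  apply: ler_sum_nat => x /andP[ax xb]; rewrite ax xb mulr1n.
  by apply: (@positive_part_le_osc _ _ _ _ s t) => //; rewrite /r; lia.
apply: ler_sum_widen => [x||x ax xb]; first exact: two_sided_osc_ge0.
  by lia.
by rewrite /W; lia.
Qed.

Lemma class_deviation n : P n ->
  \sum_(n - om n <= x < n + om n + 1) (f x - A n) = 0.
Proof.
move=> Pn; have := om_le Pn => h.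
rewrite sumrB avg_A// sumr_const_nat.
have -> : (n + om n + 1 - (n - om n) = 2 * om n + 1)%N by lia.
by rewrite mulr_natl subrr.
Qed.

(** As A n is the average of f on the ball, the negative part of the deviation
has the same sum as the positive part. *)
Lemma class_negative_part n : P n ->
  \sum_(n - om n <= x < n + om n + 1) Num.max 0 (A n - f x) <= Lam.
Proof.
move=> Pn; apply: le_trans (class_positive_part Pn).
rewrite -[leRHS]subr0 -[X in _ - X](class_deviation Pn) -sumrB.
apply: ler_sum => x _; have [h|h] := leP 0 (f x - A n); have [k|k] := leP 0 (A n - f x); lra.
Qed.

Lemma class_abs n : P n ->
  \sum_(n - om n <= x < n + om n + 1) `|f x - A n| <= 2 * Lam.
Proof.
move=> Pn; have H := lerD (class_positive_part Pn) (class_negative_part Pn).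
rewrite mulr_natl mulr2n; apply: le_trans H; rewrite -big_split/=.
apply: ler_sum => x _; rewrite -[A n - f x]opprB.
have [h|h] := leP 0 (f x - A n).
  by rewrite ger0_norm// lerDl le_max lexx.
by rewrite ltr0_norm// add0r le_max lexx orbT.
Qed.

Let gam : R := 4 * Lam / l%:R.

(** Two balls of the group share the whole cell, and f is close to both
averages there in the mean. *)
Lemma class_gap n m : P n -> P m -> A n - A m <= gam.
Proof.
move=> Pn Pm; have l0 : 0 < l%:R :> R by rewrite ltr0n.
rewrite ler_pdivlMr//.
have -> : (A n - A m) * l%:R = \sum_(c <= x < c + l) (A n - A m).
  by rewrite sumr_const_nat addnC addnK mulr_natr.
apply: (@le_trans _ _ (\sum_(c <= x < c + l) `|f x - A n| +
    \sum_(c <= x < c + l) `|f x - A m|)).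
  rewrite -big_split/=; apply: ler_sum => x _.
  have -> : A n - A m = - (f x - A n) + (f x - A m) by ring.
  by apply: (le_trans (ler_norm _)); rewrite (le_trans (ler_normD _ _))// normrN.
have sub k : P k -> \sum_(c <= x < c + l) `|f x - A k| <=
    \sum_(k - om k <= x < k + om k + 1) `|f x - A k|.
  move=> Pk; have := om_scale Pk; have := P_cell Pk; have := om_le Pk => h1 h2 h3.
  rewrite [leRHS](@big_cat_nat _ _ _ c)/=; [|lia|lia].
  rewrite [X in _ + X](@big_cat_nat _ _ _ (c + l)%N)/=; [|lia|lia].
  by rewrite addrCA lerDl addr_ge0// sumr_ge0.
have := lerD (le_trans (sub _ Pn) (class_abs Pn)) (le_trans (sub _ Pm) (class_abs Pm)).
by move/le_trans; apply; rewrite -mulrDl; have -> : 2 + 2 = 4 :> R by ring.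
Qed.

Section Levels.
Variable ns : nat.
Hypothesis P_ns : P ns.
Hypothesis ns_max : forall n, P n -> (n + om n <= ns + om ns)%N.

(* The part of the excess of f over A n that is left after all the averages of
   the group have been replaced by the single value A ns. *)
Let v n : R := d n * (l%:R / 2) - 2 * gam.
Let hi (t : R) := A ns + gam + t.
Let lo (t : R) := A ns - gam - t.
(** For the first and the last n with t < v n, the relation
2 n = (left end) + (right end) bounds their distance by the spread of the left
ends plus the spread of the right ends.  Between the two left ends every point
is enclosed at the level hi t, since f is above hi t at both of these ends.
Between the two right ends a point is either low, f x <= lo t, or enclosed at
the level lo t.  The low points are counted in the ball of ns: its right end is
the largest of all, so this ball contains them up to two positions. *)
Lemma class_level_count (t : R) : 0 <= t ->
  \sum_(0 <= n < T | P n) (t < v n)%R%:R <=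
  3 * (\sum_(0 <= x < T | W x) (enclosed f r (hi t) x)%:R +
       \sum_(0 <= x < T | W x) (enclosed f r (lo t) x)%:R +
       \sum_(ns - om ns <= x < ns + om ns + 1) (f x <= lo t)%R%:R) :> R.
Proof.
move=> t0.
have [[n0 n0P]|none] := pselect (exists n, P n && (t < v n)); last first.
  rewrite big1 => [|n Pn]; last first.
    by case: ltP => // tv; case: none; exists n; rewrite Pn tv.
  by rewrite mulr_ge0// !addr_ge0// sumr_ge0.
have exQ : exists n, P n && (t < v n) by exists n0.
have ubQ n : P n && (t < v n) -> (n <= T)%N.
  by move=> /andP[/P_cell]; have := T_large; lia.
case: (ex_minnP exQ) => n1 /andP[Pn1 v1] min1.
case: (ex_maxnP exQ ubQ) => n2 /andP[Pn2 v2] max2.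
have n12 : (n1 <= n2)%N by apply: min1; rewrite Pn2.
have gap_ns n : P n -> A n <= A ns + gam /\ A ns <= A n + gam.
  move=> Pn; have := class_gap Pn P_ns; have := class_gap P_ns Pn; lra.
have HX n : P n -> t < v n -> exists x, [/\ (n <= x + om n)%N, (x + om n <= n.+1)%N & hi t < f x].
  move=> Pn vn; have [x [h1 h2 h3]] := high_left Pn; exists x; split => //.
  apply: lt_le_trans h3; have := gap_ns n Pn; move: vn; rewrite /v /hi; lra.
have HT n : P n -> t < v n ->
   exists x, [/\ (n + om n < x)%N, (x <= n + om n + 2)%N & f x <= lo t].
  move=> Pn vn; have [x [h1 h2 h3]] := low_right Pn; exists x; split => //.
  apply: (le_trans h3); have := gap_ns n Pn; move: vn; rewrite /v /lo; lra.
have HS n : P n -> exists s, [/\ (n <= s + 3 * om n)%N, (s + om n < n)%N & f s <= hi t].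
  move=> Pn; have [x [h1 h2 h3]] := low_left Pn; exists x; split => //.
  apply: (le_trans h3); have := gap_ns n Pn; rewrite /hi; lra.
have gam0 : 0 <= gam.
  by rewrite /gam divr_ge0// mulr_ge0// sumr_ge0// => x _; exact: two_sided_osc_ge0.
have lohi : lo t <= hi t by rewrite /lo /hi; lra.
have [x1 [x1a x1b fx1]] := HX _ Pn1 v1.
have [x2 [x2a x2b fx2]] := HX _ Pn2 v2.
have [t1 [t1a t1b ft1]] := HT _ Pn1 v1.
have [t2 [t2a t2b ft2]] := HT _ Pn2 v2.
have [s1 [s1a s1b fs1]] := HS _ Pn1.
have [s2 [s2a s2b fs2]] := HS _ Pn2.
have gt0 := l_gt0.
have bx n x : P n -> (n <= x + om n)%N -> (x + om n <= n.+1)%N ->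
    (c <= x + 2 * l)%N /\ (x < c + l)%N.
  move=> Pn; move: (om_scale Pn) (P_cell Pn) gt0; clear; lia.
have bt n x : P n -> (n + om n < x)%N -> (x <= n + om n + 2)%N ->
    [/\ c + l < x, x <= c + 3 * l & x <= ns + om ns + 2]%N.
  move=> Pn; move: (om_scale Pn) (P_cell Pn) (ns_max Pn) gt0; clear => *; split; lia.
have bs n s x : P n -> (n <= s + 3 * om n)%N -> (s + om n < n)%N ->
    (n <= x + om n)%N -> (s < x)%N /\ (c <= s + 6 * l)%N.
  move=> Pn; move: (om_scale Pn) (P_cell Pn) gt0; clear; lia.
have [bx1 bx1'] := bx _ _ Pn1 x1a x1b.
have [bx2 bx2'] := bx _ _ Pn2 x2a x2b.
have [bt1 bt1' bt1''] := bt _ _ Pn1 t1a t1b.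
have [bt2 bt2' bt2''] := bt _ _ Pn2 t2a t2b.
have [bs1 bs1'] := bs _ _ _ Pn1 s1a s1b x1a.
have [bs2 bs2'] := bs _ _ _ Pn2 s2a s2b x2a.
have bns : (ns - om ns <= c)%N /\ (ns + om ns + 1 <= T)%N.
  by move: (om_scale P_ns) (P_cell P_ns) gt0 T_large; clear; lia.
pose dx := (maxn x1 x2 - minn x1 x2)%N.
pose dt := (maxn t1 t2 - minn t1 t2)%N.
have bn : (2 * (n2.+1 - n1) <= dx + dt + 4)%N.
  move: n12 (om_le Pn1) (om_le Pn2) x1a x1b x2a x2b t1a t1b t2a t2b.
  rewrite /dx /dt; clear.
  by case: (leqP x1 x2); case: (leqP t1 t2); lia.
have C1 : (dx + 1)%:R <= \sum_(0 <= x < T | W x) (enclosed f r (hi t) x)%:R :> R.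
  have -> : (dx + 1 = (maxn x1 x2).+1 - minn x1 x2)%N by rewrite /dx; clear; lia.
  apply: count_ge; first by move: bx1' bx2' T_large; clear; lia.
  move=> x xa xb; split.
    by move: xa xb bx1 bx1' bx2 bx2'; rewrite /W; clear; lia.
  have [xx|xx] := leqP x1 x2.
    apply: (@enclosed_between _ _ _ _ x s1 t2 x1 x2) => //.
    - by move: xx xa xb bs1 bx2' bt2; clear; lia.
    - by move: xx xa xb; clear; lia.
    - by move: xx xa xb bs1 bs1' bx2'; rewrite /r; clear; lia.
    - by move: xx xa xb bt2 bt2' bx1 bx2'; rewrite /r; clear; lia.
    - exact: le_trans ft2 lohi.
  apply: (@enclosed_between _ _ _ _ x s2 t1 x2 x1) => //.
  - by move: xx xa xb bs2 bx1' bt1; clear; lia.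
  - by move: xx xa xb; clear; lia.
  - by move: xx xa xb bs2 bs2' bx1'; rewrite /r; clear; lia.
  - by move: xx xa xb bt1 bt1' bx2 bx1'; rewrite /r; clear; lia.
  - exact: le_trans ft1 lohi.
have C23 : (dt - 1)%:R <= \sum_(0 <= x < T | W x) (enclosed f r (lo t) x)%:R +
     \sum_(ns - om ns <= x < ns + om ns + 1) (f x <= lo t)%R%:R :> R.
  have -> : (dt - 1 = (maxn t1 t2).-1 - minn t1 t2)%N by rewrite /dt; clear; lia.
  rewrite [X in _ + X](big_nat_widenl _ 0%N)//.
  rewrite [X in _ + X](big_nat_widen _ _ T); last by case: bns.
  rewrite [X in X + _]big_mkcond [X in _ + X]big_mkcond -big_split/=.
  apply: (@le_trans _ _ (\sum_(0 <= x < T | (minn t1 t2 <= x < (maxn t1 t2).-1)%N) (true)%:R)).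
    apply: count_ge => [|x -> ->//].
    by move: bt1' bt2' T_large; clear; lia.
  rewrite big_mkcond/=; apply: ler_sum => x _.
  case: ifP => [xx|_]; last by case: ifP => _; case: ifP => _; rewrite ?addr0 ?add0r ?addr_ge0.
  have -> : W x by move: xx bt1 bt1' bt2 bt2'; rewrite /W; clear; lia.
  have -> : (ns - om ns <= x)%N && (x < ns + om ns + 1)%N.
    by move: xx bt1 bt1'' bt2 bt2'' bns; clear; lia.
  have [fx|fx] := leP (f x) (lo t); first by rewrite lerDr.
  have -> : enclosed f r (lo t) x; last by rewrite lerDl.
  have [tt|tt] := leqP t1 t2.
    apply: (@enclosed_between _ _ _ _ x t1 t2 x x) => //;
      by move: tt xx bt1 bt1' bt2 bt2'; rewrite /r; clear; lia.
  apply: (@enclosed_between _ _ _ _ x t2 t1 x x) => //;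
    by move: tt xx bt1 bt1' bt2 bt2'; rewrite /r; clear; lia.
have C0 : \sum_(0 <= n < T | P n) (t < v n)%R%:R <= (n2.+1 - n1)%:R :> R.
  apply: count_le => n Pn tv; rewrite min1 ?Pn//= ltnS.
  by apply: max2; rewrite Pn.
apply: (le_trans C0).
have H : 2 * (n2.+1 - n1)%:R <= dx%:R + dt%:R + 4 :> R.
  by rewrite -natrM -!natrD ler_nat.
have H2 : dt%:R <= (dt - 1)%:R + 1 :> R by rewrite natr1 ler_nat; clear; lia.
have H3 : 0 <= dx%:R :> R by [].
have H4 : 0 <= dt%:R :> R by [].
have H5 : 0 <= (dt-1)%:R :> R by [].
move: C1 C23; rewrite natrD.
set S1 := \sum_(0 <= _ < T | _) _; set S2 := \sum_(0 <= _ < T | _) _.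
set S3 := \sum_(_ <= _ < _) _.
lra.
Qed.

(** Integration of the previous count over t >= 0; the terms at the levels hi t
and lo t both give the two-sided oscillation, and the low points give the
negative part of the deviation on the ball of ns. *)
Lemma class_excess_sum :
  \sum_(0 <= n < T | P n) Num.max 0 (v n) <= 9 * Lam.
Proof.
pose g := A ns + gam; pose g' := A ns - gam.
have gam0 : 0 <= gam.
  by rewrite /gam divr_ge0// mulr_ge0// sumr_ge0// => x _; exact: two_sided_osc_ge0.
pose M := two_sided_max f r; pose m := two_sided_min f r.
have I1 := @level_integral_sum R nat (index_iota 0 T) P _ _
  (fun n _ => level_integral_itv true true 0 (v n)).
have I2 := @level_integral_sum R nat (index_iota 0 T) W _ _
  (fun x _ => level_integral_itv true false (m x - g) (M x - g)).
have I3 := @level_integral_sum R nat (index_iota 0 T) W _ _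
  (fun x _ => level_integral_itv true false (g' - M x) (g' - m x)).
have I4 := @level_integral_sum R nat (index_iota (ns - om ns) (ns + om ns + 1))
  xpredT _ _ (fun x _ => level_integral_itv true false 0 (g' - f x)).
have I5 := level_integralZ (ler0n R 3) (level_integralD (level_integralD I2 I3) I4).
have := level_integral_le I1 I5.
under eq_bigr do rewrite subr0.
rewrite /=; move=> H; apply: (le_trans (H _)) => {H} [t|].
  have [t0|t0] := ltP t 0.
    rewrite big1 => [|n Pn]; last by rewrite in_itv/= leNgt t0.
    by rewrite mulr_ge0// !addr_ge0// sumr_ge0.
  have H := class_level_count t0.
  rewrite (eq_bigr (fun n => (t < v n)%R%:R)) => [|n Pn]; last first.
    by rewrite in_itv/= t0.
  apply: (le_trans H); rewrite ler_wpM2l// !lerD//.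
  - apply: ler_sum => x _; rewrite ler_nat /enclosed in_itv/= /hi.
    case: andP => // -[h1 h2]; rewrite lt0b; apply/andP; split.
      by rewrite lerBlDl.
    by rewrite lerBrDl ltW.
  - apply: ler_sum => x _; rewrite ler_nat /enclosed in_itv/= /lo.
    case: andP => // -[h1 h2]; rewrite lt0b; apply/andP; split.
      by move: h2; rewrite /g' /M; lra.
    by move: h1; rewrite /g' /m; lra.
  - apply: ler_sum => x _; rewrite ler_nat in_itv/= /lo t0/=.
    have [h|//] := leP (f x) _; rewrite lt0b.
    by move: h; rewrite /g'; lra.
have -> : 9 * Lam = 3 * (Lam + Lam + Lam) by ring.
rewrite ler_wpM2l// !lerD//.
- by apply: ler_sum => x _; rewrite /two_sided_osc opprB addrA addrNK.
- apply: ler_sum => x _; rewrite /two_sided_osc -/(m x) -/(M x).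
  by have -> : g' - m x - (g' - M x) = M x - m x by ring.
- apply: le_trans (class_negative_part P_ns); apply: ler_sum => x _.
  rewrite subr0 ge_max !le_max lexx/=; apply/orP; right.
  by rewrite /g'; move: gam0; lra.
Qed.

End Levels.

(** A group has at most l members, so that replacing d n * (l / 2) by v n costs
at most 2 gam l = 8 Lam. *)
Lemma class_descent_sum :
  \sum_(0 <= n < T | P n) d n <= 34 / l%:R * Lam.
Proof.
have Lam0 : 0 <= Lam by apply: sumr_ge0 => x _; exact: two_sided_osc_ge0.
have [[n0 n0P]|none] := pselect (exists n, P n); last first.
  rewrite big1 => [|n Pn]; last by case: none; exists n.
  by rewrite mulr_ge0// divr_ge0.
have exQ : exists m, `[< exists n, P n /\ (n + om n = m)%N >].
  by exists (n0 + om n0)%N; apply/asboolP; exists n0.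
have ubQ m : `[< exists n, P n /\ (n + om n = m)%N >] -> (m <= 2 * T)%N.
  move=> /asboolP[n [Pn <-]].
  by have := P_cell Pn; have := om_le Pn; have := T_large; lia.
case: (ex_maxnP exQ ubQ) => _ /asboolP[ns [P_ns <-]] ns_max'.
have {}ns_max n : P n -> (n + om n <= ns + om ns)%N.
  by move=> Pn; apply: ns_max'; apply/asboolP; exists n.
have lr : 0 < l%:R :> R by rewrite ltr0n.
have := class_excess_sum P_ns ns_max => H.
have gam0 : 0 <= gam by rewrite /gam divr_ge0// mulr_ge0.
have cnt : \sum_(0 <= n < T | P n) (true)%:R <= l%:R :> R.
  have -> : l = (c + l - c)%N by lia.
  by apply: count_le => n Pn _; exact: P_cell.
have {H} : \sum_(0 <= n < T | P n) d n * (l%:R / 2) <= 17 * Lam.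
  have -> : 17 * Lam = 9 * Lam + 2 * gam * l%:R.
    by rewrite /gam -!mulrA mulVf ?gt_eqF// mulr1; ring.
  apply: le_trans (lerD H (ler_wpM2l _ cnt)); last by rewrite mulr_ge0.
  rewrite mulr_sumr -big_split/=; apply: ler_sum => n Pn.
  by rewrite mulr1 -lerBlDr le_max lexx orbT.
rewrite -mulr_suml -ler_pdivlMr ?divr_gt0// => H; apply: (le_trans H).
by rewrite le_eqVlt; apply/orP; left; apply/eqP; field; rewrite gt_eqF.
Qed.

End ScaleClass.

(** * Summation over scales at a fixed level *)

Section ScaleSums.
Variable R : realType.

(** A geometric series starting at the first k with g <= a 2 ^ k. *)
Lemma dyadic_tail_sum (a g m : nat) : (0 < g)%N ->
  \sum_(0 <= k < m) (g <= a * 2 ^ k)%N%:R / (2 ^ k)%:R <= 2 * a%:R / g%:R :> R.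
Proof.
move=> g0; have g0R : 0 < g%:R :> R by rewrite ltr0n.
have p0 k : 0 < (2 ^ k)%:R :> R by rewrite ltr0n expn_gt0.
(* The remainder 2 / 2 ^ m of the geometric series makes the induction work. *)
suff H : \sum_(0 <= k < m) (g <= a * 2 ^ k)%N%:R / (2 ^ k)%:R <=
    (if (g <= a * 2 ^ m)%N then 2 * a%:R / g%:R - 2 / (2 ^ m)%:R else 0) :> R.
  apply: (le_trans H); case: ifP => _; last by rewrite divr_ge0// mulr_ge0.
  by rewrite gerBl divr_ge0.
elim: m => [|m IH].
  rewrite big_geq//; case: ifP => // ga; rewrite expn0 divr1 subr_ge0.
  by rewrite ler_pdivlMr// ler_pM2l// ler_nat; rewrite expn0 muln1 in ga.
rewrite big_nat_recr//=; have [ga|ga] := leqP g (a * 2 ^ m).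
  rewrite (leq_trans ga) ?leq_mul2l ?leq_exp2l ?leqnSn ?orbT//.
  rewrite ga in IH; apply: (le_trans (lerD IH (lexx _))).
  by rewrite mul1r expnS natrM -addrA lerD2l; rewrite le_eqVlt; apply/orP; left; apply/eqP; field; rewrite gt_eqF.
rewrite leqNgt ga /= in IH; rewrite mul0r addr0; apply: (le_trans IH).
case: ifP => // ga'; rewrite subr_ge0 ler_pdivrMr// mulrAC ler_pdivlMr//.
by rewrite -mulrA ler_pM2l// -natrM ler_nat.
Qed.

Lemma sum_indicator_le1 (P : pred nat) (T : nat) :
  (forall i j, P i -> P j -> i = j) ->
  \sum_(0 <= i < T) (P i)%:R <= 1 :> R.
Proof.
move=> P1; have [[i0 Pi0]|none] := pselect (exists i, P i).
  have := @count_le R xpredT P i0 i0.+1 T; rewrite subSnn; apply=> x _ Px.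
  by rewrite (P1 x i0)//= leqnn ltnSn.
rewrite big1 // => i _; case: (boolP (P i)) => // Pi.
by case: none; exists i.
Qed.

End ScaleSums.

Section Gaps.
Variables (R : realType) (ed : pred nat).

Definition consecutive (e e' : nat) : bool :=
  [&& ed e, ed e', (e < e')%N & ~~ has ed (iota e.+1 (e' - e.+1))].

Lemma consecutive_ed e e' x : consecutive e e' -> ed x -> (e < x)%N ->
  (e' <= x)%N.
Proof.
move=> /and4P[_ _ ee' /hasPn H] edx ex; rewrite leqNgt; apply/negP => xe'.
have := H x; rewrite mem_iota edx ex/= subnKC// xe' => /(_ isT).
by [].
Qed.

Lemma consecutive_inj_r e e1 e2 : consecutive e e1 -> consecutive e e2 -> e1 = e2.
Proof.
move=> C1 C2; apply/eqP; rewrite eqn_leq.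
have /and4P[_ d1 l1 _] := C1; have /and4P[_ d2 l2 _] := C2.
by rewrite (consecutive_ed C1)// (consecutive_ed C2).
Qed.

Lemma consecutive_inj_l e1 e2 e : consecutive e1 e -> consecutive e2 e -> e1 = e2.
Proof.
move=> C1 C2; have /and4P[d1 _ l1 _] := C1; have /and4P[d2 _ l2 _] := C2.
have [h|h|//] := ltngtP e1 e2.
  by have := consecutive_ed C1 d2 h; rewrite leqNgt l2.
by have := consecutive_ed C2 d1 h; rewrite leqNgt l1.
Qed.

Lemma consecutive_around e x e' : ed e -> (e < x)%N -> ed e' -> (x <= e')%N ->
  exists e1 e2, [/\ consecutive e1 e2, (e <= e1 < x)%N & (x <= e2 <= e')%N].
Proof.
move=> de ex de' xe'.
have ex1 : exists i, ed i && (i < x)%N by exists e; rewrite de.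
have ub1 i : ed i && (i < x)%N -> (i <= x)%N by move=> /andP[_ /ltnW].
have ex2 : exists i, ed i && (x <= i)%N by exists e'; rewrite de'.
case: (ex_maxnP ex1 ub1) => e1 /andP[d1 l1] m1.
case: (ex_minnP ex2) => e2 /andP[d2 l2] m2.
exists e1, e2; split; last 2 first.
- by rewrite l1 m1// de.
- by rewrite l2 m2// de'.
rewrite /consecutive d1 d2 (leq_trans l1 l2)/=; apply/hasPn => i.
rewrite mem_iota subnKC ?(leq_trans l1 l2)// => /andP[i1 i2].
apply/negP => di; have [ix|xi] := ltnP i x.
  by have := m1 i; rewrite di ix => /(_ isT); rewrite leqNgt i1.
by have := m2 i; rewrite di xi => /(_ isT); rewrite leqNgt i2.
Qed.

Variables (c1 c2 K T1 T2 m : nat).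
Hypothesis c12 : (c1 <= c2 < K)%N.
Hypothesis T12 : (T1 + 10 * 2 ^ m <= T2)%N.

(** The cost of a crossing for descents at positions beyond K.  Gaps inside
[c1, c2) are seen only at scales comparable to K - c2 or larger. *)
Definition edge_weight (e : nat) : R :=
  if (c1 <= e < c2)%N then (c2 - c1)%:R / (K - c2)%:R else 1.

Lemma edge_weight_ge0 e : 0 <= edge_weight e.
Proof. by rewrite /edge_weight; case: ifP => // _; rewrite divr_ge0. Qed.

Let reach (k x e e' : nat) : bool :=
  [&& consecutive e e', (e < x <= e')%N, (e' - e <= 20 * 2 ^ k)%N &
      (K <= x + 3 * 2 ^ k)%N].

(** The gap has e' - e points; the sum over k of the admissible 1 / 2 ^ k is at
most 40 / (e' - e) in any case, and at most 6 / (K - c2) if the gap lies in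
[c1, c2). *)
Lemma gap_sum e e' :
  \sum_(0 <= x < T1) \sum_(0 <= k < m) (reach k x e e')%:R / (2 ^ k)%:R <=
  (consecutive e e')%:R * (40 * (edge_weight e + edge_weight e')) :> R.
Proof.
case: (boolP (consecutive e e')) => C; last first.
  rewrite mul0r big1 // => x _; rewrite big1 // => k _.
  by rewrite /reach (negbTE C) mul0r.
rewrite mul1r; have /and4P[_ _ ee' _] := C.
have g0 : (0 < e' - e)%N by rewrite subn_gt0.
have key (Q : pred nat) B : (forall k x, reach k x e e' -> Q k) ->
    \sum_(0 <= k < m) (Q k)%:R / (2 ^ k)%:R <= B :> R ->
  \sum_(0 <= x < T1) \sum_(0 <= k < m) (reach k x e e')%:R / (2 ^ k)%:R <=
    (e' - e)%:R * B.
  move=> HQ HB.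
  apply: (@le_trans _ _ (\sum_(0 <= x < T1) (e < x <= e')%N%:R *
      \sum_(0 <= k < m) (Q k)%:R / (2 ^ k)%:R)).
    apply: ler_sum => x _; rewrite mulr_sumr; apply: ler_sum => k _.
    rewrite mulrA ler_wpM2r ?invr_ge0// -natrM ler_nat.
    case: (boolP (reach k x e e')) => // H; rewrite (HQ _ _ H).
    by have /and4P[_ -> _ _] := H.
  rewrite -mulr_suml; apply: ler_pM => //.
  - by rewrite sumr_ge0.
  - by rewrite sumr_ge0// => k _; rewrite divr_ge0.
  have -> : (e' - e = e'.+1 - e.+1)%N by rewrite subSS.
  by apply: count_le => x _; rewrite ltnS.
have [/andP[h1 h2]|h] := boolP ((c1 <= e) && (e' < c2))%N.
  have Kc : (0 < K - c2)%N by move: c12; clear; lia.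
  have := key (fun k => K - c2 <= 3 * 2 ^ k)%N _ _ (dyadic_tail_sum R 3 m Kc).
  move=> H; apply: (le_trans (H _)) => [k x /and4P[_ a _ b]|].
    by move: a b h2; clear; lia.
  have -> : edge_weight e = (c2 - c1)%:R / (K - c2)%:R.
    by rewrite /edge_weight h1 (ltn_trans ee' h2).
  apply: (@le_trans _ _ (40 * ((c2 - c1)%:R / (K - c2)%:R))); last first.
    by rewrite ler_wpM2l// lerDl edge_weight_ge0.
  rewrite !mulrA ler_wpM2r ?invr_ge0//.
  rewrite -!natrM ler_nat.
  by move: h1 h2 ee'; clear; lia.
have := key (fun k => e' - e <= 20 * 2 ^ k)%N _ _ (dyadic_tail_sum R 20 m g0).
move=> H; apply: (le_trans (H _)) => [k x /and4P[_ _ a _] //|].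
rewrite mulrC divfK ?pnatr_eq0 -?lt0n// -natrM ler_peMr//.
have w0 := edge_weight_ge0 e; have w0' := edge_weight_ge0 e'.
have [e1|e1] := ltnP e c1.
  have -> : edge_weight e = 1 by rewrite /edge_weight leqNgt e1.
  by rewrite lerDl.
have -> : edge_weight e' = 1; last by rewrite lerDr.
rewrite /edge_weight; case: ifP => // /andP[_ h2].
by move: h; rewrite e1 h2.
Qed.

Definition edges_within (k x : nat) : Prop :=
  (exists e, [/\ ed e, (e < x)%N & (x <= e + 10 * 2 ^ k)%N]) /\
  (exists e, [/\ ed e, (x <= e)%N & (e < x + 10 * 2 ^ k)%N]).

(** Each crossing belongs to at most two gaps, once as left end and once as
right end. *)
Lemma edges_within_sum :
  \sum_(0 <= x < T1) \sum_(0 <= k < m)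
    `[< edges_within k x /\ (K <= x + 3 * 2 ^ k)%N >]%:R / (2 ^ k)%:R <=
  80 * \sum_(0 <= e < T2) (ed e)%:R * edge_weight e :> R.
Proof.
apply: (@le_trans _ _ (\sum_(0 <= x < T1) \sum_(0 <= k < m)
   \sum_(0 <= e < T2) \sum_(0 <= e' < T2) (reach k x e e')%:R / (2 ^ k)%:R)).
  rewrite big_nat [leRHS]big_nat; apply: ler_sum => x /andP[_ xT].
  rewrite big_nat [leRHS]big_nat; apply: ler_sum => k /andP[_ km].
  under eq_bigr do rewrite -mulr_suml.
  rewrite -mulr_suml ler_wpM2r ?invr_ge0//.
  case: asboolP => [[[[e [de ex xe]] [e' [de' xe' ex']]] Kx]|_]; last first.
    by rewrite sumr_ge0// => ? _; rewrite sumr_ge0.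
  have [e1 [e2 [C h1 h2]]] := consecutive_around de ex de' xe'.
  have km' : (2 ^ k <= 2 ^ m)%N by rewrite leq_exp2l// ltnW.
  have e2T : (e2 < T2)%N by move: h2 ex' xT T12 km'; clear; lia.
  have e1T : (e1 < T2)%N by move: h1 h2 e2T; clear; lia.
  rewrite (bigD1_seq e1) ?iota_uniq ?mem_index_iota//=.
  rewrite (bigD1_seq e2) ?iota_uniq ?mem_index_iota//=.
  have -> : reach k x e1 e2.
    rewrite /reach C Kx andbT/=.
    by move: h1 h2 xe ex' ; clear; lia.
  by rewrite -addrA lerDl addr_ge0// sumr_ge0// => ? _; rewrite sumr_ge0.
have -> : \sum_(0 <= x < T1) \sum_(0 <= k < m)
    \sum_(0 <= e < T2) \sum_(0 <= e' < T2) (reach k x e e')%:R / (2 ^ k)%:R =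
   \sum_(0 <= e < T2) \sum_(0 <= e' < T2) \sum_(0 <= x < T1)
    \sum_(0 <= k < m) (reach k x e e')%:R / (2 ^ k)%:R :> R.
  under eq_bigr do rewrite exchange_big/=.
  rewrite exchange_big/=; apply: eq_bigr => e _.
  under eq_bigr do rewrite exchange_big/=.
  by rewrite exchange_big.
apply: (@le_trans _ _ (\sum_(0 <= e < T2) \sum_(0 <= e' < T2)
   (consecutive e e')%:R * (40 * (edge_weight e + edge_weight e')))).
  by apply: ler_sum => e _; apply: ler_sum => e' _; exact: gap_sum.
have cons_r e : \sum_(0 <= e' < T2) (consecutive e e')%:R <= (ed e)%:R :> R.
  case: (boolP (ed e)) => de; last first.
    by rewrite big1// => e' _; rewrite /consecutive (negbTE de).
  by apply: sum_indicator_le1 => i j; exact: consecutive_inj_r.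
have cons_l e' : \sum_(0 <= e < T2) (consecutive e e')%:R <= (ed e')%:R :> R.
  case: (boolP (ed e')) => de; last first.
    by rewrite big1// => e _; rewrite /consecutive (negbTE de) andbF.
  by apply: sum_indicator_le1 => i j; exact: consecutive_inj_l.
have -> : \sum_(0 <= e < T2) \sum_(0 <= e' < T2)
    (consecutive e e')%:R * (40 * (edge_weight e + edge_weight e')) =
  40 * (\sum_(0 <= e < T2) (\sum_(0 <= e' < T2) (consecutive e e')%:R) * edge_weight e
   + \sum_(0 <= e' < T2) (\sum_(0 <= e < T2) (consecutive e e')%:R) * edge_weight e').
  under [in RHS]eq_bigr do rewrite mulr_suml.
  under [X in _ = _ * (_ + X)]eq_bigr do rewrite mulr_suml.
  rewrite [X in _ = _ * (_ + X)]exchange_big/= -big_split/= mulr_sumr.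
  apply: eq_bigr => e _; rewrite -big_split/= mulr_sumr.
  by apply: eq_bigr => e' _; rewrite mulrCA mulrDr.
have -> : 80 = 40 * 2 :> R by rewrite -natrM.
rewrite -mulrA ler_wpM2l// mulr_natl mulr2n; apply: lerD.
  by apply: ler_sum => e _; rewrite ler_wpM2r ?edge_weight_ge0.
by apply: ler_sum => e _; rewrite ler_wpM2r ?edge_weight_ge0.
Qed.

End Gaps.

(** * Level crossings *)

Section Edges.
Variable R : realType.
Implicit Types (f : nat -> R).

Definition level_edge f (u : R) (e : nat) : bool := (u < f e) != (u < f e.+1).

Lemma predicate_change (p : nat -> bool) (a b : nat) : (a <= b)%N -> p a != p b ->
  exists2 e, (a <= e < b)%N & p e != p e.+1.
Proof.
elim: b => [|b IH]; first by rewrite leqn0 => /eqP ->; rewrite eqxx.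
rewrite leq_eqVlt => /predU1P[->|]; first by rewrite eqxx.
rewrite ltnS => ab pab; have [pp|pp] := eqVneq (p b) (p b.+1); last first.
  by exists b; rewrite ?ab/=.
by have [|e /andP[ae eb] pe] := IH ab; [rewrite pp|exists e; rewrite ?ae 1?ltnW].
Qed.

Lemma edge_between f u (a b y y' : nat) : (a <= y <= b)%N -> (a <= y' <= b)%N ->
  u < f y -> f y' <= u -> exists2 e, (a <= e < b)%N & level_edge f u e.
Proof.
move=> /andP[ay yb] /andP[ay' yb'] uy; rewrite leNgt => uy'.
have ne : (u < f y) != (u < f y') by rewrite uy (negbTE uy').
have [yy|yy] := leqP y y'.
  have [e /andP[e1 e2] ed] := predicate_change (p := fun x => u < f x) yy ne.
  by exists e => //; rewrite (leq_trans ay e1) (leq_trans e2 yb').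
rewrite eq_sym in ne.
have [e /andP[e1 e2] ed] := predicate_change (p := fun x => u < f x) (ltnW yy) ne.
by exists e => //; rewrite (leq_trans ay' e1) (leq_trans e2 yb).
Qed.

Lemma enclosed_edges f r u x : enclosed f r u x ->
  (exists e, [/\ level_edge f u e, (e < x)%N & (x <= e + r)%N]) /\
  (exists e, [/\ level_edge f u e, (x <= e)%N & (e < x + r)%N]).
Proof.
move=> /andP[/two_sided_min_le[[i1 r1 l1] [i2 r2 l2]]].
move=> /two_sided_max_gt[[j1 s1 h1] [j2 s2 h2]]; split.
  have [| |e /andP[e1 e2] ed] := @edge_between f u (x - r) x _ _ _ _ h2 l2.
  - by move: s2; clear; lia.
  - by move: r2; clear; lia.
  by exists e; split=> //; move: e1; clear; lia.
have [| |e /andP[e1 e2] ed] := @edge_between f u x (x + r) _ _ _ _ h1 l1.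
- by move: s1; clear; lia.
- by move: r1; clear; lia.
by exists e.
Qed.

Lemma level_integral_edge f e :
  level_integral (fun u => (level_edge f u e)%:R) `|f e.+1 - f e|.
Proof.
have -> : `|f e.+1 - f e| = Num.max 0 (Num.max (f e) (f e.+1) - Num.min (f e) (f e.+1)).
  have [h|h] := leP (f e) (f e.+1).
    by rewrite ger0_norm ?subr_ge0// max_r ?subr_ge0.
  by rewrite ltr0_norm ?subr_lt0// opprB max_r// subr_ge0 ltW.
have := level_integral_itv true true (Num.min (f e) (f e.+1)) (Num.max (f e) (f e.+1)).
congr level_integral; apply/funext => u; congr (nat_of_bool _)%:R.
rewrite in_itv/= ge_min lt_max /level_edge !leNgt.
by case: (u < f e); case: (u < f e.+1).
Qed.

End Edges.

(** * Descents of the maximal function *)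

Section Descents.
Variables (R : realType) (f G : nat -> R) (K M : nat) (om : nat -> nat).
Hypothesis avg_le : forall i r, (r <= i)%N ->
  \sum_(i - r <= x < i + r + 1) f x <= (2 * r + 1)%:R * G i.
Hypothesis avg_om : forall i, (K <= i < M)%N -> G i.+1 < G i ->
  (3 * om i <= i)%N /\
  \sum_(i - om i <= x < i + om i + 1) f x = (2 * om i + 1)%:R * G i.

Lemma function_le_maximal i : f i <= G i.
Proof.
have := avg_le (leq0n i); rewrite subn0 addn0 addn1 big_nat1.
by rewrite muln0 add0n mul1r.
Qed.

Definition two_sided_descent i : bool :=
  [&& (K <= i < M)%N, G i.+1 < G i, (0 < om i)%N &
    `[< exists s, [/\ (i <= s + 3 * om i)%N, (s + om i < i)%N & f s <= G i] >]].

Let d i : R := G i - G i.+1.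

(** The ball of radius [om i - 1] at i.+1 is the ball of i without its two
leftmost points, and its average is lower by at least [d i]; the two points
that were removed carry the difference. *)
Lemma shrunk_ball_high i : (K <= i < M)%N -> G i.+1 < G i -> (0 < om i)%N ->
  exists x, [/\ (i <= x + om i)%N, (x + om i <= i.+1)%N &
    G i + d i * ((om i)%:R / 2) <= f x].
Proof.
move=> KM lt w0; have [w3 avg] := avg_om KM lt.
have [| |x [x1 x2 fx]] := @exists_ge_average R f (i - om i) (i - om i + 2)
    (G i + d i * ((om i)%:R / 2)).
- by move: w0; clear; lia.
- have le : ((om i).-1 <= i.+1)%N by move: w3; clear; lia.
  have := avg_le le.
  have -> : (i.+1 - (om i).-1 = i - om i + 2)%N by move: w0 w3; clear; lia.
  have -> : (i.+1 + (om i).-1 + 1 = i + om i + 1)%N by move: w0; clear; lia.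
  have -> : (i - om i + 2 - (i - om i) = 2)%N by clear; lia.
  have e2 : (2 * (om i).-1 + 1)%:R = 2 * (om i)%:R - 1 :> R.
    have -> : (2 * (om i).-1 + 1 = 2 * om i - 1)%N by move: w0; clear; lia.
    by rewrite natrB ?natrM// muln_gt0.
  rewrite e2; move: avg; rewrite (@big_cat_nat _ _ _ (i - om i + 2))/=; last 2 first.
  - by clear; lia.
  - by move: w0; clear; lia.
  rewrite natrD natrM => avg H.
  have w1 : 1 <= (om i)%:R :> R by rewrite ler1n.
  have d0 : 0 < d i by rewrite subr_gt0.
  have := mulr_ge0 (ltW d0) (_ : 0 <= (om i)%:R - 1 :> R); rewrite subr_ge0 => /(_ w1).
  move: avg H; rewrite /d; set S1 := \sum_(_ <= _ < _) _; set S2 := \sum_(_ <= _ < _) _.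
  nra.
- by exists x; split=> //; move: x1 x2 w3; clear; lia.
Qed.

(** The ball of radius [om i + 1] at i.+1 is the ball of i with two points added
on the right; they pull the average down by at least [d i]. *)
Lemma enlarged_ball_low i : (K <= i < M)%N -> G i.+1 < G i ->
  exists t, [/\ (i + om i < t)%N, (t <= i + om i + 2)%N &
    f t <= G i - d i * ((om i)%:R / 2)].
Proof.
move=> KM lt; have [w3 avg] := avg_om KM lt.
have [| |x [x1 x2 fx]] := @exists_le_average R f (i + om i + 1) (i + om i + 3)
    (G i - d i * ((om i)%:R / 2)).
- by clear; lia.
- have le : ((om i).+1 <= i.+1)%N by move: w3; clear; lia.
  have := avg_le le.
  have -> : (i.+1 - (om i).+1 = i - om i)%N by clear; lia.
  have -> : (i.+1 + (om i).+1 + 1 = i + om i + 3)%N by clear; lia.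
  have -> : (i + om i + 3 - (i + om i + 1) = 2)%N by clear; lia.
  rewrite (@big_cat_nat _ _ _ (i + om i + 1))/=; [|clear; lia|clear; lia].
  rewrite avg !natrD !natrM -[(om i).+1]addn1 natrD => H.
  have d0 : 0 < d i by rewrite subr_gt0.
  have := mulr_ge0 (ltW d0) (ler0n R (om i)).
  move: H; rewrite /d; set S2 := \sum_(_ <= _ < _) _.
  nra.
- by exists x; split=> //; move: x1 x2; clear; lia.
Qed.

(** If f were at most u on (p, i], then the high point at the left end of the
ball of i would lie at or before p.  So the ball at p that ends where the ball
of i ends extends it only to the left, by 2 (i - p) <= 2 om i points, and since
its average is at most G p < G i some added point has f at most G i: the
descent would be two-sided. *)
Lemma one_sided_descent i p u : (K <= i < M)%N -> G i.+1 < G i ->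
  ~~ two_sided_descent i -> (K <= p < i)%N -> G p <= u -> u < G i ->
  exists2 x, (p < x <= i)%N & u < f x.
Proof.
move=> KM lt bad /andP[Kp pi] Gp ui; apply: contrapT => none.
have low x : (p < x <= i)%N -> f x <= u.
  by move=> px; rewrite leNgt; apply/negP => ux; apply: none; exists x.
have [w3 avg] := avg_om KM lt.
have w0 : (0 < om i)%N.
  rewrite lt0n; apply/eqP => w0; move: avg.
  rewrite w0 subn0 addn0 addn1 big_nat1 muln0 add0n mul1r => fG.
  by have := low i; rewrite pi leqnn fG leNgt ui => /(_ isT).
have [x [x1 x2 fx]] := shrunk_ball_high KM lt w0.
have xp : (x <= p)%N.
  rewrite leqNgt; apply/negP => px; have := low x.
  rewrite px (_ : (x <= i)%N) => [/(_ isT)|]; last by move: x2 w0; clear; lia.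
  apply/negP; rewrite -ltNge; apply: lt_le_trans fx; apply: (lt_le_trans ui).
  by rewrite lerDl mulr_ge0 ?subr_ge0 ?(ltW lt)// divr_ge0.
move/negP: bad; apply; rewrite /two_sided_descent KM lt w0/=; apply/asboolP.
have rp : (om i + (i - p) <= p)%N by move: x1 xp w3 pi; clear; lia.
have := avg_le rp.
have -> : (p + (om i + (i - p)) + 1 = i + om i + 1)%N by move: pi; clear; lia.
rewrite (@big_cat_nat _ _ _ (i - om i))/=; last 2 first.
- by move: x1 xp w3 pi; clear; lia.
- by clear; lia.
rewrite avg => H.
have [| |s [s1 s2 fs]] := @exists_le_average R f (p - (om i + (i - p))) (i - om i) (G i).
- by move: pi rp w3 x1 xp; clear; lia.
- have -> : (i - om i - (p - (om i + (i - p))) = 2 * (i - p))%N.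
    by move: pi rp w3 x1 xp; clear; lia.
  have e1 : (2 * (om i + (i - p)) + 1)%:R = 2 * (om i)%:R + 2 * (i - p)%:R + 1 :> R.
    by ring.
  have e2 : (2 * om i + 1)%:R = 2 * (om i)%:R + 1 :> R by ring.
  have e3 : (2 * (i - p))%:R = 2 * (i - p)%:R :> R by ring.
  move: H; rewrite e1 e2 e3; set S := \sum_(_ <= _ < _) _ => H.
  have p0 : 0 <= (i - p)%:R :> R by [].
  have q0 : 0 <= (om i)%:R :> R by [].
  have GG : G p <= G i by rewrite (le_trans Gp) ?ltW.
  have := ler_wpM2l p0 GG; have := ler_wpM2l q0 GG.
  move: H; lra.
by exists s; split=> //; move: s1 s2 pi rp w3 x1 xp; clear; lia.
Qed.

(** At most one of the descents through the level u has no earlier p >= K with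
G p <= u; it is counted by the first term on the right.  For any other, at m
say, take the last such p: there is a crossing of u between p and m, and no
other descent through u. *)
Lemma one_sided_level_count (glow u : R) :
  (forall i, (K <= i <= M)%N -> glow <= G i) -> forall m, (K <= m <= M)%N ->
  \sum_(K <= i < m | ~~ two_sided_descent i) (G i.+1 <= u < G i)%R%:R <=
  (glow <= u < G K)%R%:R + \sum_(K <= e < m) (level_edge f u e)%:R :> R.
Proof.
move=> Glow m; elim/ltn_ind: m => -[|m] IH /andP[Km mM].
  by rewrite big_geq// addr_ge0// sumr_ge0.
move: Km; rewrite leq_eqVlt => /predU1P[<-|].
  by rewrite !big_geq// addr0.
rewrite ltnS => Km.
have IHm : \sum_(K <= i < m | ~~ two_sided_descent i) (G i.+1 <= u < G i)%R%:R <=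
  (glow <= u < G K)%R%:R + \sum_(K <= e < m) (level_edge f u e)%:R :> R.
  by apply: IH => //; rewrite Km ltnW.
have edm : 0 <= \sum_(m <= e < m.+1) (level_edge f u e)%:R :> R by rewrite sumr_ge0.
have rec (B : R) : B <= (glow <= u < G K)%R%:R + \sum_(K <= e < m) (level_edge f u e)%:R ->
  B <= (glow <= u < G K)%R%:R + \sum_(K <= e < m.+1) (level_edge f u e)%:R.
  move=> HB; apply: (le_trans HB).
  by rewrite (@big_cat_nat _ _ _ m K m.+1)//= addrA lerDl.
rewrite [leLHS](@big_cat_nat _ _ _ m K m.+1)//= big_mkcond/=.
rewrite [X in _ + X]big_mkcond/= big_nat1 -big_mkcond/=.
case: ifP => [bad|_]; last by rewrite addr0; exact: rec.
case: (boolP (G m.+1 <= u < G m)) => [/andP[Gm1 um]|_]; last first.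
  by rewrite addr0; exact: rec.
have lt : G m.+1 < G m by exact: le_lt_trans um.
have KM : (K <= m < M)%N by rewrite Km mM.
have [[p0 p0P]|none] := pselect (exists p, (K <= p < m)%N && (G p <= u)%R); last first.
  have Gu i : (K <= i <= m)%N -> u < G i.
    move=> /andP[Ki]; rewrite leq_eqVlt => /predU1P[->//|im].
    by rewrite ltNge; apply/negP => Gi; apply: none; exists i; rewrite Ki im.
  rewrite big_nat_cond big1 ?add0r => [|i]; last first.
    move=> /andP[/andP[Ki im] _]; case: (boolP (_ && _)) => // /andP[Gi _].
    by have := Gu i.+1; rewrite im (leqW Ki) ltNge Gi => /(_ isT).
  have -> : glow <= u < G K.
    by rewrite Gu ?leqnn// (le_trans (Glow m.+1 _))// mM leqW.
  by rewrite lerDl sumr_ge0.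
have exQ : exists p, (K <= p < m)%N && (G p <= u)%R by exists p0.
have ubQ p : (K <= p < m)%N && (G p <= u)%R -> (p <= m)%N.
  by move=> /andP[/andP[_ /ltnW]].
case: (ex_maxnP exQ ubQ) => p /andP[/andP[Kp pm] Gp] pmax.
have [x /andP[px xm] ux] := one_sided_descent KM lt bad (introT andP (conj Kp pm)) Gp um.
have fm1 : f m.+1 <= u by rewrite (le_trans (function_le_maximal _)).
have [| |e /andP[e1 e2] ed] := @edge_between R f u p m.+1 x m.+1 _ _ ux fm1.
- by rewrite ltnW//= leqW.
- by rewrite leqnn andbT leqW// ltnW.
have IHp := IH p (leq_trans pm (leqnSn m)).
have {}IHp := IHp (introT andP (conj Kp (ltnW (leq_trans pm (ltnW mM))))).
rewrite (@big_cat_nat _ _ _ p K m)//=; [|exact: ltnW].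
rewrite [X in _ + X + _]big_nat_cond [X in _ + X + _]big1 ?addr0 => [|i]; last first.
  move=> /andP[/andP[pi im] _]; case: (boolP (_ && _)) => // /andP[Gi _].
  move: im; rewrite leq_eqVlt => /predU1P[im|im].
    by move: um; rewrite -im ltNge Gi.
  have := pmax i.+1; rewrite im Gi (leq_trans Kp)/= ?(leqW pi)// => /(_ isT).
  by rewrite ltnNge pi.
rewrite (@big_cat_nat _ _ _ p K m.+1)//=; [|by rewrite leqW// ltnW].
rewrite addrA; apply: lerD => //.
rewrite (bigD1_seq e) ?iota_uniq//=; last by rewrite mem_index_iota e1.
by rewrite ed lerDl sumr_ge0.
Qed.

Lemma one_sided_descent_sum (glow : R) : (K <= M)%N ->
  (forall i, (K <= i <= M)%N -> glow <= G i) ->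
  \sum_(K <= i < M | ~~ two_sided_descent i) Num.max 0 (d i) <=
  (G K - glow) + \sum_(K <= e < M) `|f e.+1 - f e|.
Proof.
move=> KM Glow.
have I1 := @level_integral_sum R nat (index_iota K M) (fun i => ~~ two_sided_descent i)
  _ _ (fun i _ => level_integral_itv true true (G i.+1) (G i)).
have I2 := level_integralD (level_integral_itv true true glow (G K))
  (@level_integral_sum R nat (index_iota K M) xpredT _ _
    (fun e _ => level_integral_edge f e)).
have -> : G K - glow = Num.max 0 (G K - glow).
  by rewrite max_r// subr_ge0 Glow// leqnn KM.
apply: (level_integral_le I1 I2) => u; rewrite in_itv/=.
under eq_bigr do rewrite in_itv/=.
by apply: one_sided_level_count; rewrite ?KM ?leqnn.
Qed.

End Descents.

(** * The sum of the two-sided descents *)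

Section TwoSidedSum.
Variables (R : realType) (f G : nat -> R) (K M : nat) (om : nat -> nat).
Hypothesis avg_le : forall i r, (r <= i)%N ->
  \sum_(i - r <= x < i + r + 1) f x <= (2 * r + 1)%:R * G i.
Hypothesis avg_om : forall i, (K <= i < M)%N -> G i.+1 < G i ->
  (3 * om i <= i)%N /\
  \sum_(i - om i <= x < i + om i + 1) f x = (2 * om i + 1)%:R * G i.
Variables (c1 c2 : nat).
Hypothesis c12 : (c1 <= c2 < K)%N.

Let d i : R := G i - G i.+1.
Let T1 := (4 * M).+1.
Let T2 := (T1 + 10 * 2 ^ M)%N.

Let near_cell k q x : bool :=
  (q * 2 ^ k <= x + 2 * 2 ^ k)%N && (x <= q * 2 ^ k + 3 * 2 ^ k)%N.
Let in_class k q i : bool :=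
  [&& two_sided_descent f G K M om i, (2 ^ k <= om i < 2 * 2 ^ k)%N &
      (q * 2 ^ k <= i < q * 2 ^ k + 2 ^ k)%N].

(** A group with a member contains some n >= K, hence K <= x + 3 2 ^ k on its
window. *)
Lemma class_sum_le k q :
  \sum_(0 <= i < T1 | in_class k q i) d i <=
  34 / (2 ^ k)%:R * \sum_(0 <= x < T1 | near_cell k q x)
    (K <= x + 3 * 2 ^ k)%N%:R * two_sided_osc f (10 * 2 ^ k) x.
Proof.
have [[i0 P0]|none] := pselect (exists i, in_class k q i); last first.
  rewrite big1 => [|i Pi]; last by case: none; exists i.
  rewrite mulr_ge0 ?divr_ge0// sumr_ge0// => x _.
  by rewrite mulr_ge0 ?two_sided_osc_ge0.
have /and3P[/and4P[KM0 lt0 _ _] om0 cell0] := P0.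
have [w3 _] := avg_om KM0 lt0.
have p0 : (0 < 2 ^ k)%N by rewrite expn_gt0.
have -> : \sum_(0 <= x < T1 | near_cell k q x)
    (K <= x + 3 * 2 ^ k)%N%:R * two_sided_osc f (10 * 2 ^ k) x =
  \sum_(0 <= x < T1 | near_cell k q x) two_sided_osc f (10 * 2 ^ k) x.
  apply: eq_bigr => x /andP[h _]; rewrite (_ : (K <= _)%N) ?mul1r//.
  by move: h KM0 cell0; clear; lia.
have sub i : in_class k q i -> [/\ two_sided_descent f G K M om i,
    (K <= i < M)%N, G i.+1 < G i, (0 < om i)%N & (2 ^ k <= om i < 2 * 2 ^ k)%N].
  by move=> /and3P[/[dup] ? /and4P[? ? ? _] ? _].
apply: (@class_descent_sum R f G d om (in_class k q) T1 (2 ^ k) (q * 2 ^ k)) => //.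
- by rewrite /T1; move: KM0 om0 cell0 w3; clear; lia.
- by move=> i /sub[].
- by move=> i /and3P[].
- by move=> i /sub[_ h1 h2 _ _]; have [+ _] := avg_om h1 h2; clear; lia.
- by move=> i /sub[_ h1 h2 _ _]; have [_ +] := avg_om h1 h2.
- by move=> i /sub[/and4P[_ _ _ /asboolP]].
- move=> i /sub[_ h1 h2 h3 /andP[h4 _]].
  have [x [x1 x2 fx]] := shrunk_ball_high avg_le avg_om h1 h2 h3.
  exists x; split=> //; apply: le_trans fx; rewrite lerD2l ler_wpM2l//.
    by rewrite subr_ge0 ltW.
  by rewrite ler_wpM2r// ler_nat.
- move=> i /sub[_ h1 h2 h3 /andP[h4 _]].
  have [x [x1 x2 fx]] := enlarged_ball_low avg_le avg_om h1 h2.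
  exists x; split=> //; apply: (le_trans fx); rewrite lerD2l lerN2 ler_wpM2l//.
    by rewrite subr_ge0 ltW.
  by rewrite ler_wpM2r// ler_nat.
- by move=> i /sub[_ _ h _ _]; rewrite subr_ge0 ltW.
Qed.

Lemma near_cell_count k x :
  \sum_(0 <= q < M) (near_cell k q x)%:R <= 6 :> R.
Proof.
have p0 : (0 < 2 ^ k)%N by rewrite expn_gt0.
pose y := (x %/ 2 ^ k)%N.
apply: (@le_trans _ _ (y + 3 - (y - 3))%:R); last first.
  by rewrite ler_nat; clear; lia.
apply: count_le => q _ /andP[h1 h2].
have y1 : (y * 2 ^ k <= x)%N := leq_divM _ _.
have y2 : (x < y.+1 * 2 ^ k)%N := ltn_ceil _ p0.
have q1 : (q < y + 3)%N.
  rewrite -(ltn_pmul2r p0) mulnDl; apply: (leq_ltn_trans h1).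
  by move: y2; rewrite mulSn; clear; lia.
have q2 : (y <= q + 3)%N.
  rewrite -(leq_pmul2r p0) mulnDl; exact: leq_trans h2.
by move: q1 q2; clear; lia.
Qed.

(** 204 = 34 * 6, with 34 from each group and at most 6 windows of each scale
around a point; 80 = 40 * 2, with 40 from each gap and two gaps at each
crossing. *)
Lemma two_sided_descent_sum :
  \sum_(0 <= i < T1 | two_sided_descent f G K M om i) d i <=
  204 * 80 * \sum_(0 <= e < T2) edge_weight R c1 c2 K e * `|f e.+1 - f e|.
Proof.
have d0 i : two_sided_descent f G K M om i -> 0 <= d i.
  by move=> /and4P[_ h _ _]; rewrite subr_ge0 ltW.
apply: (@le_trans _ _ (\sum_(0 <= k < M) \sum_(0 <= q < M)
    \sum_(0 <= i < T1 | in_class k q i) d i)).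
  have -> : \sum_(0 <= k < M) \sum_(0 <= q < M) \sum_(0 <= i < T1 | in_class k q i) d i =
     \sum_(0 <= i < T1) \sum_(0 <= k < M) \sum_(0 <= q < M) if in_class k q i then d i else 0.
    under eq_bigr do under eq_bigr do rewrite big_mkcond/=.
    by under eq_bigr do rewrite exchange_big/=; rewrite exchange_big.
  rewrite big_mkcond/=; apply: ler_sum => i _.
  have nn k q : 0 <= if in_class k q i then d i else 0.
    by case: ifP => // /and3P[/d0].
  case: ifP => [good|_]; last by rewrite sumr_ge0// => ? _; rewrite sumr_ge0.
  have /and4P[KM lt w0 _] := good; have [w3 _] := avg_om KM lt.
  pose k := trunc_log 2 (om i); pose q := (i %/ 2 ^ k)%N.
  have p0 : (0 < 2 ^ k)%N by rewrite expn_gt0.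
  have k1 : (2 ^ k <= om i)%N by exact: trunc_logP.
  have k2 : (om i < 2 * 2 ^ k)%N by rewrite -expnS; exact: trunc_log_ltn.
  have kM : (k < M)%N.
    by have := ltn_expl k (isT : (1 < 2)%N); move: k1 w3 KM; clear; lia.
  have q1 : (q * 2 ^ k <= i)%N := leq_divM _ _.
  have q2 : (i < q.+1 * 2 ^ k)%N := ltn_ceil _ p0.
  have qM : (q < M)%N by apply: leq_ltn_trans (leq_div _ _) _; case/andP: KM.
  rewrite (bigD1_seq k) ?iota_uniq ?mem_index_iota//=.
  rewrite (bigD1_seq q) ?iota_uniq ?mem_index_iota//=.
  have -> : in_class k q i by rewrite /in_class good k1 k2 q1 -mulSnr q2.
  by rewrite -addrA lerDl addr_ge0// sumr_ge0// => ? _; rewrite sumr_ge0.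
apply: (@le_trans _ _ (\sum_(0 <= x < T1) \sum_(0 <= k < M)
    204 / (2 ^ k)%:R * (K <= x + 3 * 2 ^ k)%N%:R * two_sided_osc f (10 * 2 ^ k) x)).
  rewrite [leRHS]exchange_big/=; apply: ler_sum => k _.
  apply: (@le_trans _ _ (\sum_(0 <= q < M) 34 / (2 ^ k)%:R *
     \sum_(0 <= x < T1 | near_cell k q x)
    (K <= x + 3 * 2 ^ k)%N%:R * two_sided_osc f (10 * 2 ^ k) x)).
    by apply: ler_sum => q _; exact: class_sum_le.
  have -> : \sum_(0 <= q < M) 34 / (2 ^ k)%:R * \sum_(0 <= x < T1 | near_cell k q x)
      (K <= x + 3 * 2 ^ k)%N%:R * two_sided_osc f (10 * 2 ^ k) x =
    \sum_(0 <= x < T1) 34 / (2 ^ k)%:R * \sum_(0 <= q < M)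
      (if near_cell k q x then
       (K <= x + 3 * 2 ^ k)%N%:R * two_sided_osc f (10 * 2 ^ k) x else 0).
    rewrite -!mulr_sumr; congr (_ * _); rewrite exchange_big/=.
    by apply: eq_bigr => q _; rewrite big_mkcond.
  apply: ler_sum => x _; set a := (_)%:R * two_sided_osc _ _ _.
  have a0 : 0 <= a by rewrite mulr_ge0 ?two_sided_osc_ge0.
  have -> : \sum_(0 <= q < M) (if near_cell k q x then a else 0) =
     (\sum_(0 <= q < M) (near_cell k q x)%:R) * a.
    by rewrite mulr_suml; apply: eq_bigr => q _; case: ifP; rewrite ?mul1r ?mul0r.
  rewrite -[X in _ <= X]mulrA -/a.
  apply: (@le_trans _ _ (34 / (2 ^ k)%:R * (6 * a))).
    by rewrite ler_wpM2l ?divr_ge0// ler_wpM2r// near_cell_count.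
  by rewrite le_eqVlt; apply/orP; left; apply/eqP; ring.
have I1 := @level_integral_sum R nat (index_iota 0 T1) xpredT _ _ (fun x _ =>
  @level_integral_sum R nat (index_iota 0 M) xpredT _ _ (fun k _ =>
   level_integralZ (_ : 0 <= 204 / (2 ^ k)%:R * (K <= x + 3 * 2 ^ k)%N%:R)
    (level_integral_itv true true (two_sided_min f (10 * 2 ^ k) x)
       (two_sided_max f (10 * 2 ^ k) x)))).
have I2 := level_integralZ (mulr_ge0 (ler0n R 204) (ler0n R 80))
  (@level_integral_sum R nat (index_iota 0 T2) xpredT _ _ (fun e _ =>
    level_integralZ (edge_weight_ge0 R c1 c2 K e) (level_integral_edge f e))).
apply: (level_integral_le (I1 _) I2) => [x k|u].
  by rewrite mulr_ge0 ?divr_ge0.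
have E := @edges_within_sum R (level_edge f u) c1 c2 K T1 T2 M c12 (leqnn _).
apply: (@le_trans _ _ (204 * (80 * \sum_(0 <= e < T2) (level_edge f u e)%:R * edge_weight R c1 c2 K e))); last first.
  rewrite mulrA le_eqVlt; apply/orP; left; apply/eqP; congr (_ * _).
  by apply: eq_bigr => e _; rewrite mulrC.
apply: le_trans (ler_wpM2l _ E) => //.
rewrite mulr_sumr; apply: ler_sum => x _; rewrite mulr_sumr; apply: ler_sum => k _.
rewrite -!mulrA ler_wpM2l// [leLHS]mulrC ler_wpM2r ?invr_ge0//.
rewrite -natrM ler_nat in_itv/=.
case: (boolP (K <= _)%N) => Kx; last by rewrite mul0n.
rewrite mul1n; case: (boolP (_ && _)) => //= enc.
by rewrite lt0b; apply/asboolP; split=> //; exact: enclosed_edges enc.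
Qed.

End TwoSidedSum.

(** * Variation of the maximal function on a half-line *)

Section NatTail.
Variables (R : realType) (f G : nat -> R) (K M : nat) (om : nat -> nat).
Hypothesis avg_le : forall i r, (r <= i)%N ->
  \sum_(i - r <= x < i + r + 1) f x <= (2 * r + 1)%:R * G i.
Hypothesis avg_om : forall i, (K <= i < M)%N -> G i.+1 < G i ->
  (3 * om i <= i)%N /\
  \sum_(i - om i <= x < i + om i + 1) f x = (2 * om i + 1)%:R * G i.
Variables (c1 c2 : nat) (o B : R).
Hypothesis c12 : (c1 <= c2 < K)%N.
Hypothesis KM : (K <= M)%N.
Hypothesis osc_G : forall i, (K <= i <= M)%N -> `|G i - G K| <= o.
Hypothesis edges_le : forall T,
  \sum_(0 <= e < T) edge_weight R c1 c2 K e * `|f e.+1 - f e| <= B.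

Lemma descent_sum_le :
  \sum_(K <= i < M) Num.max 0 (G i - G i.+1) <= o + (1 + 204 * 80) * B.
Proof.
have c0 : 0 <= 204 * 80 :> R by rewrite mulr_ge0.
have one : \sum_(K <= i < M | ~~ two_sided_descent f G K M om i)
    Num.max 0 (G i - G i.+1) <= o + B.
  have Glow i : (K <= i <= M)%N -> G K - o <= G i.
    by move=> /osc_G; rewrite ler_norml => /andP[+ _]; lra.
  apply: (le_trans (one_sided_descent_sum avg_le avg_om KM Glow)).
  rewrite subKr lerD2l; apply: le_trans (edges_le M).
  rewrite [leRHS](@big_cat_nat _ _ _ K)//=; apply: ler_wpDl.
    by apply: sumr_ge0 => e _; rewrite mulr_ge0 ?edge_weight_ge0.
  apply: ler_sum_nat => e /andP[Ke _]; rewrite /edge_weight.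
  case: ifP => [/andP[_ h]|_]; last by rewrite mul1r.
  by move: c12 h Ke; clear; lia.
have two : \sum_(K <= i < M | two_sided_descent f G K M om i)
    Num.max 0 (G i - G i.+1) <= 204 * 80 * B.
  apply: le_trans (le_trans (two_sided_descent_sum avg_le avg_om c12) _).
    rewrite (big_nat_widenl _ 0%N)// (big_nat_widen _ _ (4 * M).+1)/=; last first.
      by clear; lia.
    rewrite big_mkcond [leRHS]big_mkcond/=; apply: ler_sum => i _.
    case: (boolP (two_sided_descent f G K M om i)) => [/and4P[_ lt _ _]|//].
    have lt' : 0 <= G i - G i.+1 by rewrite subr_ge0 ltW.
    by rewrite /=; case: ifP => // _; rewrite max_r.
  by rewrite ler_wpM2l.
rewrite (bigID (two_sided_descent f G K M om))/= addrC mulrDl mul1r addrA.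
exact: lerD.
Qed.

(** The total variation is twice the sum of the descents plus the increment of
G between the ends. *)
Lemma nat_tail_variation :
  \sum_(K <= i < M) `|G i.+1 - G i| <= 3 * o + 2 * (1 + 204 * 80) * B.
Proof.
have -> : \sum_(K <= i < M) `|G i.+1 - G i| =
    2 * (\sum_(K <= i < M) Num.max 0 (G i - G i.+1)) + (G M - G K).
  rewrite -telescope_sumr// mulr_sumr -big_split/=; apply: eq_bigr => i _.
  have [h|h] := leP 0 (G i - G i.+1).
    by rewrite ler0_norm; lra.
  by rewrite ger0_norm; lra.
have H1 := descent_sum_le.
have H2 : G M - G K <= o.
  by apply: le_trans (ler_norm _) (osc_G _); rewrite KM leqnn.
rewrite -mulrA; move: H1; set D := (1 + _) * B; set S := \sum_(_ <= _ < _) _; lra.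
Qed.

End NatTail.

Section IntTail.
Variables (R : realType) (g G : int -> R) (N K M : nat) (o B : R).

Definition ball_sum (h : int -> R) (n : int) (r : nat) : R :=
  \sum_(0 <= k < (2 * r + 1)%N) h (n + (k%:Z - r%:Z)).

Hypothesis ball_le : forall n r, ball_sum g n r <= (2 * r + 1)%:R * G n.
Hypothesis ball_attained : forall n, G (n + 1) < G n ->
  exists r, ball_sum g n r = (2 * r + 1)%:R * G n.
Hypothesis NK : (N < K)%N.
Hypothesis KM : (K <= M)%N.
Hypothesis osc_G : forall i : nat, (K <= i <= M)%N -> `|G i%:Z - G K%:Z| <= o.
Hypothesis edges_le : forall X T : nat, (N <= X)%N ->
  \sum_(0 <= e < T) edge_weight R (X - N) (X + N) (X + K) e *
     `|g (e%:Z - X%:Z + 1) - g (e%:Z - X%:Z)| <= B.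

(** Only finitely many balls are involved; after a translation they all lie, with
room of three radii to the left, in the natural numbers. *)
Lemma tail_variation :
  \sum_(K <= i < M) `|G (i%:Z + 1) - G i%:Z| <= 3 * o + 2 * (1 + 204 * 80) * B.
Proof.
pose om (n : int) : nat := xget 0%N [set r | ball_sum g n r = (2 * r + 1)%:R * G n].
have omP n : G (n + 1) < G n -> ball_sum g n (om n) = (2 * om n + 1)%:R * G n.
  by move=> /ball_attained[r Hr]; rewrite /om; case: xgetP => [_ _ //|/(_ r)].
pose X := (N + 3 * \sum_(0 <= i < M) om i%:Z)%N.
have omX i : (i < M)%N -> (3 * om i%:Z <= X)%N.
  move=> iM; apply: leq_trans (leq_addl _ _); rewrite leq_mul2l/=.
  by rewrite (bigD1_seq i) ?iota_uniq ?mem_index_iota//= leq_addr.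
pose sh (h : int -> R) (i : nat) := h (i%:Z - X%:Z).
have shE (h : int -> R) i : sh h i.+1 = h (i%:Z - X%:Z + 1).
  by rewrite /sh; congr h; clear; lia.
have ballE i r : (r <= i)%N ->
    \sum_(i - r <= x < i + r + 1) sh g x = ball_sum g (i%:Z - X%:Z) r.
  move=> ri; rewrite -[(i - r)%N]add0n big_addn /ball_sum.
  have -> : (i + r + 1 - (i - r) = 2 * r + 1)%N by move: ri; clear; lia.
  by apply: eq_bigr => k _; rewrite /sh; congr g; move: ri; clear; lia.
have := @nat_tail_variation R (sh g) (sh G) (X + K) (X + M)
  (fun i => om (i%:Z - X%:Z)) _ _ (X - N) (X + N) o B.
have -> : \sum_(X + K <= i < X + M) `|sh G i.+1 - sh G i| =
   \sum_(K <= i < M) `|G (i%:Z + 1) - G i%:Z|.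
  rewrite addnC big_addn addKn; apply: eq_bigr => i _; rewrite shE /sh.
  by congr `|G _ - G _|; clear; lia.
apply.
- by move=> i r ri; rewrite ballE.
- move=> i iKM; rewrite shE => lt.
  have w3 : (3 * om (i%:Z - X%:Z)%R <= i)%N.
    have e : i%:Z - X%:Z = (i - X)%N%:Z by move: iKM; clear; lia.
    have := omX (i - X)%N; rewrite -e => H; apply: leq_trans (H _) _.
      by move: iKM; clear; lia.
    by move: iKM; clear; lia.
  split=> //; rewrite ballE; first exact: omP.
  by move: w3; clear; lia.
- by move: NK; clear; lia.
- by rewrite leq_add2l.
- move=> i iKM.
  have e : i%:Z - X%:Z = (i - X)%N%:Z by move: iKM; clear; lia.
  have e' : (X + K)%N%:Z - X%:Z = K%:Z by clear; lia.
  by rewrite /sh e e'; apply: osc_G; move: iKM; clear; lia.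
- move=> T; under eq_bigr do rewrite shE.
  by apply: edges_le; rewrite leq_addr.
Qed.

End IntTail.

(** * The centered maximal function of a bounded function *)

Section MaximalFunction.
Variable R : realType.
Implicit Types (f h : int -> R).

Let ball_avg f n r : R := (2 * r + 1)%N%:R^-1 * ball_sum (fun i => `|f i|) n r.

Lemma centered_maximalE f n :
  centered_maximal f n = sup [set ball_avg f n r | r in [set: nat]].
Proof. by []. Qed.

Let w0 r : 0 < (2 * r + 1)%:R :> R.
Proof. by rewrite ltr0n addn1. Qed.

Lemma ball_avg_le f n r (B : R) : (forall i, `|f i| <= B) -> ball_avg f n r <= B.
Proof.
move=> fB; rewrite /ball_avg mulrC ler_pdivrMr// mulrC mulr_natl.
rewrite -[X in _ *+ X]subn0 -sumr_const_nat; exact: ler_sum.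
Qed.

Lemma ball_avg_le_maximal f n r (B : R) : (forall i, `|f i| <= B) ->
  ball_avg f n r <= centered_maximal f n.
Proof.
move=> fB; rewrite centered_maximalE; apply: ub_le_sup; last by exists r.
by exists B => _ [s _ <-]; exact: ball_avg_le.
Qed.

Lemma centered_maximal_le f n c : (forall r, ball_avg f n r <= c) ->
  centered_maximal f n <= c.
Proof.
move=> le_c; rewrite centered_maximalE; apply: ge_sup.
  by exists (ball_avg f n 0%N); exists 0%N.
by move=> _ [r _ <-].
Qed.

Lemma maximal_ball_sum_le f n r (B : R) : (forall i, `|f i| <= B) ->
  ball_sum (fun i => `|f i|) n r <= (2 * r + 1)%:R * centered_maximal f n.
Proof.
move=> fB; rewrite mulrC -ler_pdivrMr// mulrC; exact: ball_avg_le_maximal fB.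
Qed.

Lemma normr_maximal_le f n (B : R) : (forall i, `|f i| <= B) ->
  `|centered_maximal f n| <= B.
Proof.
move=> fB; rewrite ger0_norm; first by apply: centered_maximal_le => r; exact: ball_avg_le.
apply: le_trans (ball_avg_le_maximal n 0 fB).
by rewrite mulr_ge0 ?invr_ge0// sumr_ge0.
Qed.

Lemma maximal_dist_le f h n (B B' e : R) : (forall i, `|f i| <= B) ->
  (forall i, `|h i| <= B') -> (forall i, `|f i - h i| <= e) ->
  `|centered_maximal f n - centered_maximal h n| <= e.
Proof.
suff le f' h' C : (forall i, `|h' i| <= C) -> (forall i, `|f' i - h' i| <= e) ->
    centered_maximal f' n <= centered_maximal h' n + e.
  move=> fB hB fh; rewrite ler_norml; apply/andP; split.
    rewrite lerNl opprB lerBlDl; apply: le fB _ => i; by rewrite distrC.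
  by rewrite lerBlDl; apply: le hB _.
move=> hC fh; apply: centered_maximal_le => r.
apply: le_trans (lerD (ball_avg_le_maximal n r hC) (lexx _)).
rewrite -lerBlDl /ball_avg -mulrBr mulrC ler_pdivrMr// mulrC mulr_natl.
rewrite -[X in _ *+ X]subn0 -sumr_const_nat /ball_sum -sumrB.
by apply: ler_sum => i _; apply: le_trans (lerB_dist _ _) (fh _).
Qed.

(** The two balls differ by one point on each side. *)
Lemma ball_sum_shift f n r (B : R) : (forall i, `|f i| <= B) ->
  ball_sum (fun i => `|f i|) n r - ball_sum (fun i => `|f i|) (n + 1) r <= B.
Proof.
move=> fB; rewrite /ball_sum -sumrB.
rewrite (eq_bigr (fun k : nat => - `|f (n + (k.+1%:Z - r%:Z))| -
    (- `|f (n + (k%:Z - r%:Z))|))) => [|k _]; last first.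
  rewrite opprK addrC; congr (- `|f _| + _); clear; lia.
rewrite telescope_sumr// opprK -[leRHS]add0r lerD// oppr_le0; exact: normr_ge0.
Qed.

(** Averages over large balls at n and at n + 1 differ by little, so at n they
stay below a bound smaller than the supremum; finitely many radii remain. *)
Lemma maximal_attained f n (B : R) : (forall i, `|f i| <= B) ->
  centered_maximal f (n + 1) < centered_maximal f n ->
  exists r, ball_sum (fun i => `|f i|) n r = (2 * r + 1)%:R * centered_maximal f n.
Proof.
move=> fB lt; set c := centered_maximal f n; apply: contrapT => none.
have B0 : 0 <= B by apply: le_trans (fB 0).
have strict r : ball_avg f n r < c.
  rewrite lt_neqAle (ball_avg_le_maximal _ _ fB) andbT; apply/eqP => e.
  apply: none; exists r; rewrite -e /ball_avg mulrA mulfV ?mul1r//.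
pose dl := c - centered_maximal f (n + 1).
have dl0 : 0 < dl by rewrite subr_gt0.
pose r0 := Num.truncn (B / dl).
have [c' cc' Hc'] : exists2 c', c' < c & forall r, (r <= r0)%N -> ball_avg f n r <= c'.
  elim: r0 => [|k [c1 c1c IH]].
    by exists (ball_avg f n 0%N) => // r; rewrite leqn0 => /eqP ->.
  exists (Num.max c1 (ball_avg f n k.+1)); first by rewrite gt_max c1c strict.
  move=> r; rewrite leq_eqVlt => /predU1P[->|rk]; first by rewrite le_max lexx orbT.
  by rewrite le_max IH.
have : c <= Num.max c' (c - dl / 2); last first.
  by apply/negP; rewrite -ltNge gt_max cc' gtrBl divr_gt0.
apply: centered_maximal_le => r; rewrite le_max; have [/Hc' ->//|r0r] := leqP r r0.
apply/orP; right.
have H1 := ball_sum_shift n r fB.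
have H2 : ball_sum (fun i => `|f i|) (n + 1) r <= (2 * r + 1)%:R * (c - dl).
  by rewrite /dl subKr; exact: maximal_ball_sum_le fB.
have H3 : B <= (2 * r + 1)%:R * (dl / 2).
  have : B / dl < r%:R.
    apply: (lt_le_trans (truncnS_gt _)); by rewrite ler_nat.
  rewrite ltr_pdivrMr// => H; apply: (le_trans (ltW H)).
  have -> : (2 * r + 1)%:R * (dl / 2) = r%:R * dl + dl / 2 by field.
  by rewrite lerDl divr_ge0 ?ltW.
rewrite /ball_avg mulrC ler_pdivrMr// mulrC.
move: H1 H2 H3; set w := (2 * r + 1)%:R; nra.
Qed.

End MaximalFunction.

(** * Variation on symmetric windows and outside them *)

Section PartialVariation.
Variable R : realType.
Implicit Types (f h : int -> R).

Definition partial_var f (m : nat) : R :=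
  \sum_(0 <= i < 2 * m) `|dderiv f (i%:Z - m%:Z)|.

(** The part of [partial_var f m] outside the window of [partial_var f N]. *)
Definition outer_var f (N m : nat) : R :=
  \sum_(0 <= i < 2 * m | ~~ (m - N <= i < m + N)%N) `|dderiv f (i%:Z - m%:Z)|.

Lemma partial_var_split f N m : (N <= m)%N ->
  partial_var f m = partial_var f N + outer_var f N m.
Proof.
move=> Nm; rewrite /partial_var (bigID (fun i => (m - N <= i < m + N)%N))/=.
congr (_ + _).
have -> : \sum_(0 <= i < 2 * m | (m - N <= i < m + N)%N) `|dderiv f (i%:Z - m%:Z)| =
    \sum_(m - N <= i < m + N) `|dderiv f (i%:Z - m%:Z)|.
  rewrite [RHS](big_nat_widenl _ 0%N)// [RHS](big_nat_widen _ _ (2 * m))//.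
  by move: Nm; clear; lia.
rewrite -[(m - N)%N]add0n big_addn.
have -> : (m + N - (m - N) = 2 * N)%N by move: Nm; clear; lia.
by apply: eq_bigr => i _; congr `|dderiv _ _|; move: Nm; clear; lia.
Qed.

Lemma outer_var_ge0 f N m : 0 <= outer_var f N m.
Proof. exact: sumr_ge0. Qed.

Lemma partial_var_ge0 f m : 0 <= partial_var f m.
Proof. exact: sumr_ge0. Qed.

Lemma partial_var_le_Var f m : ((partial_var f m)%:E <= Var f)%E.
Proof.
pose e := fun i : nat => i%:Z - m%:Z : int.
apply: le_trans (Var_ge f (finite_image e (finite_II (2 * m)))).
rewrite /= /partial_var big_mkord -sumEFin fsbig_image; last first.
  by move=> i j _ _ /addIr [].
by rewrite -fsbig_ord.
Qed.

Lemma Var_le f (c : R) : (forall m, partial_var f m <= c) -> (Var f <= c%:E)%E.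
Proof.
move=> Pc; apply: ge_ereal_sup => _ [A [finA _] <-].
have [m Am] : exists m : nat, forall a, A a -> (`|a| < m)%N.
  have /finite_seqP[s ->] := finA.
  exists (\sum_(a <- s) `|a|.+1)%N => a /= sa.
  by rewrite (big_rem a)//= ltnS leq_addr.
pose e := fun i : nat => i%:Z - m%:Z : int.
have finI := finite_image e (finite_II (2 * m)).
apply: (@le_trans _ _ (\sum_(n \in [set e i | i in `I_(2 * m)]) `|dderiv f n|%:E)%E).
  apply: lee_fsum_nneg_subset => //.
  move=> a; rewrite !inE => Aa; exists (absz (a + m%:Z)).
    by rewrite /=; have := Am a Aa; clear; lia.
  by rewrite /e; have := Am a Aa; clear; lia.
rewrite fsbig_image; last by move=> i j _ _ /addIr [].
by rewrite -fsbig_ord sumEFin lee_fin; have := Pc m; rewrite /partial_var big_mkord.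
Qed.

Lemma dist_le_sum_dderiv f m (i j : nat) : (i <= j)%N ->
  `|f (j%:Z - m%:Z) - f (i%:Z - m%:Z)| <=
  \sum_(i <= k < j) `|dderiv f (k%:Z - m%:Z)|.
Proof.
move=> ij.
rewrite -(@telescope_sumr _ _ _ (fun k : nat => f (k%:Z - m%:Z)))//.
apply: (le_trans (ler_norm_sum _ _ _)).
rewrite le_eqVlt; apply/orP; left; apply/eqP; apply: eq_bigr => k _.
by rewrite /dderiv; congr `|f _ - _|; clear; lia.
Qed.

End PartialVariation.

(** * Tails of the variation of the maximal function *)

Section BVTails.
Variable R : realType.
Implicit Types (f h : int -> R).

Definition reflection f : int -> R := fun n => f (- n).

Lemma dderiv_reflection f n : `|dderiv (reflection f) n| = `|dderiv f (- n - 1)|.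
Proof. by rewrite /dderiv /reflection distrC opprD subrK. Qed.

Lemma outer_var_reflection f N m :
  outer_var (reflection f) N m = outer_var f N m.
Proof.
rewrite /outer_var big_nat_rev/= add0n big_nat_cond [RHS]big_nat_cond.
apply: eq_big => [i|i /andP[/andP[_ im] _]].
  case: (boolP (0 <= i < 2 * m)%N) => //= im; congr (~~ _).
  by move: im; clear; lia.
rewrite dderiv_reflection; congr `|dderiv _ _|.
by move: im; clear; lia.
Qed.

Lemma partial_var_reflection f m :
  partial_var (reflection f) m = partial_var f m.
Proof.
have /(_ 0%N m (leq0n m)) := @partial_var_split R f.
have /(_ 0%N m (leq0n m)) := @partial_var_split R (reflection f).
by rewrite outer_var_reflection => -> ->; rewrite /partial_var muln0 !big_geq.
Qed.

Lemma outer_var_sides f K m : (K <= m)%N ->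
  outer_var f K m = \sum_(K <= j < m) `|dderiv f j%:Z| +
     \sum_(K <= j < m) `|dderiv (reflection f) j%:Z|.
Proof.
move=> Km; rewrite /outer_var (@big_cat_nat _ _ _ (m - K))//=; last by clear; lia.
rewrite [X in _ + X](@big_cat_nat _ _ _ (m + K))/=; last 2 first.
- by clear; lia.
- by move: Km; clear; lia.
rewrite [X in _ + (X + _)]big_nat_cond [X in _ + (X + _)]big_pred0 ?add0r => [|i]; last first.
  by case: (m - K <= i < m + K)%N.
rewrite addrC; congr (_ + _).
  rewrite addnC big_addn; have -> : (2 * m - m = m)%N by clear; lia.
  rewrite big_nat_cond [RHS]big_nat_cond.
  apply: eq_big => [i|i _]; last by congr `|dderiv _ _|; clear; lia.
  by move: Km; clear; lia.
have -> : \sum_(K <= j < m) `|dderiv (reflection f) j%:Z| =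
   \sum_(0 <= j < m - K) `|dderiv (reflection f) (j + K)%N%:Z|.
  by rewrite -[X in \sum_(X <= _ < _) _]add0n big_addn.
rewrite [RHS]big_nat_rev/= big_nat_cond [RHS]big_nat_cond.
apply: eq_big => [i|i /andP[im _]].
  by clear; lia.
rewrite dderiv_reflection; congr `|dderiv _ _|; move: im; clear; lia.
Qed.

Lemma maximal_reflection f n :
  centered_maximal (reflection f) n = centered_maximal f (- n).
Proof.
rewrite /centered_maximal; congr sup; apply/seteqP; split=> _ [r _ <-]; exists r => //;
  congr (_ * _); rewrite big_nat_rev/=; apply: eq_big_nat => k kr;
  congr `|_|; rewrite /reflection; congr f; move: kr; clear; lia.
Qed.

Lemma partial_var_mono f N m : (N <= m)%N -> partial_var f N <= partial_var f m.
Proof. by move=> Nm; rewrite (partial_var_split f Nm) lerDl outer_var_ge0. Qed.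

Lemma outer_var_anti f N N' m : (N <= N' <= m)%N ->
  outer_var f N' m <= outer_var f N m.
Proof.
move=> /andP[NN' N'm]; have := partial_var_mono f NN'.
have := partial_var_split f N'm; have := partial_var_split f (leq_trans NN' N'm).
by lra.
Qed.

Lemma partial_var_le f m (V : R) : (Var f <= V%:E)%E -> partial_var f m <= V.
Proof.
by move=> fV; rewrite -lee_fin; apply: le_trans (partial_var_le_Var f m) fV.
Qed.

(** The variation is the supremum of its parts on symmetric windows. *)
Lemma outer_var_small f (V e : R) : (Var f = V%:E)%E -> 0 < e ->
  exists N, forall m, (N <= m)%N -> outer_var f N m <= e.
Proof.
move=> fV e0; have [N PN] : exists N, V - e < partial_var f N.
  apply: contrapT => none.
  have : (Var f <= (V - e)%:E)%E.
    apply: Var_le => m; rewrite leNgt; apply/negP => Pm; apply: none.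
    by exists m.
  by rewrite fV lee_fin lerBrDr -subr_ge0 opprD addNKr oppr_ge0 leNgt e0.
exists N => m Nm; have := @partial_var_le f m V.
rewrite fV lexx (partial_var_split f Nm) => /(_ isT); lra.
Qed.

Lemma weighted_var_le f N K X T (s V : R) : (N < K)%N -> (N <= X)%N ->
  (forall m, (N <= m)%N -> outer_var f N m <= s) ->
  (forall m, partial_var f m <= V) ->
  \sum_(0 <= e < T) edge_weight R (X - N) (X + N) (X + K) e *
     `|f (e%:Z - X%:Z + 1) - f (e%:Z - X%:Z)| <=
  s + (2 * N)%:R / (K - N)%:R * V.
Proof.
move=> NK NX outer_s part_V; pose m := (X + T)%N.
pose c : R := (2 * N)%:R / (K - N)%:R.
have c0 : 0 <= c by rewrite divr_ge0.
pose F (i : nat) : R := (if (m - N <= i < m + N)%N then c else 1) *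
  `|dderiv f (i%:Z - m%:Z)|.
have F0 i : 0 <= F i by rewrite mulr_ge0//; case: ifP.
apply: (@le_trans _ _ (\sum_(0 <= e < T) F (e + T)%N)).
  rewrite le_eqVlt; apply/orP; left; apply/eqP; apply: eq_bigr => e _.
  rewrite /F /edge_weight /dderiv; congr (_ * _).
    have -> : (X - N <= e < X + N)%N = (m - N <= e + T < m + N)%N.
      by rewrite /m; move: NX; clear; lia.
    case: ifP => // _; rewrite /c; congr (_%:R / _%:R).
      by move: NX; clear; lia.
    by clear; lia.
  by congr `|f _ - f _|; rewrite /m; clear; lia.
have -> : \sum_(0 <= e < T) F (e + T)%N = \sum_(T <= i < T + T) F i.
  by rewrite -[X in _ = \sum_(X <= _ < _) _]add0n big_addn addnK.
apply: (@le_trans _ _ (\sum_(0 <= i < 2 * m) F i)).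
  by apply: ler_sum_widen => //; rewrite /m; clear; lia.
apply: (@le_trans _ _ (outer_var f N m + c * partial_var f m)); last first.
  by rewrite lerD ?ler_wpM2l// outer_s// /m; move: NX; clear; lia.
rewrite /outer_var [X in _ <= X + _]big_mkcond/= /partial_var mulr_sumr -big_split/=.
apply: ler_sum => i _; rewrite /F; case: ifP => _ /=; first by rewrite add0r.
by rewrite mul1r lerDl mulr_ge0.
Qed.

Section MaximalTails.
Variables (f : int -> R) (B s V o : R) (N K : nat).
Hypothesis fB : forall i, `|f i| <= B.
Hypothesis NK : (N < K)%N.
Hypothesis outer_s : forall m, (N <= m)%N -> outer_var f N m <= s.
Hypothesis part_V : forall m, partial_var f m <= V.
Let G := centered_maximal f.

Lemma maximal_tail_variation (M : nat) : (K <= M)%N ->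
  (forall i : nat, (K <= i <= M)%N -> `|G i%:Z - G K%:Z| <= o) ->
  \sum_(K <= i < M) `|dderiv G i%:Z| <=
  3 * o + 2 * (1 + 204 * 80) * (s + (2 * N)%:R / (K - N)%:R * V).
Proof.
move=> KM osc; apply: (@tail_variation R (fun i => `|f i|) G N K M) => //.
- by move=> n r; exact: maximal_ball_sum_le fB.
- by move=> n; exact: maximal_attained fB.
- move=> X T NX; apply: le_trans (weighted_var_le T NK NX outer_s part_V).
  apply: ler_sum => e _; rewrite ler_wpM2l ?edge_weight_ge0//.
  exact: ler_dist_dist.
Qed.

End MaximalTails.

(** The tail at minus infinity is the tail at plus infinity of the reflected
function. *)
Lemma maximal_outer_var f (B s V o : R) (N K m : nat) :
  (forall i, `|f i| <= B) -> (N < K)%N -> (K <= m)%N ->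
  (forall m, (N <= m)%N -> outer_var f N m <= s) ->
  (forall m, partial_var f m <= V) ->
  (forall i : nat, (K <= i)%N ->
     `|centered_maximal f i%:Z - centered_maximal f K%:Z| <= o /\
     `|centered_maximal f (- i%:Z) - centered_maximal f (- K%:Z)| <= o) ->
  outer_var (centered_maximal f) K m <=
  2 * (3 * o + 2 * (1 + 204 * 80) * (s + (2 * N)%:R / (K - N)%:R * V)).
Proof.
move=> fB NK Km outer_s part_V osc.
rewrite outer_var_sides// [leRHS]mulr_natl mulr2n; apply: lerD.
  apply: (maximal_tail_variation fB NK outer_s part_V Km) => i /andP[Ki _].
  by have [] := osc i Ki.
have -> : reflection (centered_maximal f) = centered_maximal (reflection f).
  by apply/funext => n; rewrite maximal_reflection.
apply: (@maximal_tail_variation (reflection f) B s V o N K) => //.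
- by move=> i; exact: fB.
- by move=> m' Nm'; rewrite outer_var_reflection outer_s.
- by move=> m'; rewrite partial_var_reflection part_V.
- by move=> i /andP[Ki _]; rewrite !maximal_reflection; have [] := osc i Ki.
Qed.

Lemma dist_le_outer_var f K i : (K <= i)%N ->
  `|f i%:Z - f K%:Z| <= outer_var f K i /\
  `|f (- i%:Z) - f (- K%:Z)| <= outer_var f K i.
Proof.
suff pos h : (K <= i)%N -> `|h i%:Z - h K%:Z| <= \sum_(K <= j < i) `|dderiv h j%:Z|.
  move=> Ki; rewrite outer_var_sides//; split.
    by apply: (le_trans (pos f Ki)); rewrite lerDl sumr_ge0.
  by apply: (le_trans (pos (reflection f) Ki)); rewrite lerDr sumr_ge0.
move=> Ki; rewrite -(@telescope_sumr _ _ _ (fun k : nat => h k%:Z))//.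
apply: (le_trans (ler_norm_sum _ _ _)).
rewrite le_eqVlt; apply/orP; left; apply/eqP; apply: eq_bigr => k _.
by rewrite /dderiv; congr `|h _ - _|; clear; lia.
Qed.

Lemma dist_le_Var f (V : R) a b : (Var f <= V%:E)%E -> `|f a - f b| <= V.
Proof.
move=> fV; wlog ab : a b / a <= b => [H|].
  by have [/H//|/ltW/H] := leP a b; rewrite distrC.
rewrite distrC; pose m := (absz a + absz b)%N.
pose i := absz (a + m%:Z); pose j := absz (b + m%:Z).
have -> : a = i%:Z - m%:Z by rewrite /i /m; clear; lia.
have -> : b = j%:Z - m%:Z by rewrite /j /m; clear; lia.
have ij : (i <= j <= 2 * m)%N by rewrite /i /j /m; move: ab; clear; lia.
have /andP[ij1 ij2] := ij; apply: le_trans (dist_le_sum_dderiv f m ij1) _.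
apply: le_trans (partial_var_le m fV); rewrite /partial_var.
exact: (@ler_sum_widen R _ xpredT).
Qed.

Lemma normr_le_BV f (n : int) : f \in Defs.bounded_variation ->
  `|f n| <= `|lim_ninfty f| + fine (Var f).
Proof.
move=> fBV; have fV : (Var f <= (fine (Var f))%:E)%E.
  by move/asboolP: (fBV) => h; rewrite fineK// ge0_fin_numE ?Var_ge0.
have cvg := is_cvg_ninfty fBV.
have H1 : f n - fine (Var f) <= lim_ninfty f.
  apply: limr_ge => //; apply: nearW => k.
  have := dist_le_Var n (- k%:Z) fV; rewrite ler_norml => /andP[_].
  by rewrite lerBlDr lerBlDr addrC.
have H2 : lim_ninfty f <= f n + fine (Var f).
  apply: limr_le => //; apply: nearW => k.
  have := dist_le_Var (- k%:Z) n fV; rewrite ler_norml => /andP[_].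
  by rewrite lerBlDr addrC.
have := ler_norm (lim_ninfty f); have := ler_norm (- lim_ninfty f); rewrite normrN.
by move=> H3 H4; rewrite ler_norml; apply/andP; split; lra.
Qed.

Lemma lim_ninfty_le f (B : R) : f \in Defs.bounded_variation ->
  (forall n, `|f n| <= B) -> `|lim_ninfty f| <= B.
Proof.
move=> fBV fB; have cvg := is_cvg_ninfty fBV; rewrite ler_norml; apply/andP; split.
  by apply: limr_ge => //; apply: nearW => k; have := fB (- k%:Z); rewrite ler_norml => /andP[].
by apply: limr_le => //; apply: nearW => k; have := fB (- k%:Z); rewrite ler_norml => /andP[].
Qed.

(** The empty window N = 0 and K = 1 suffice here. *)
Lemma maximal_bounded_variation f : f \in Defs.bounded_variation ->
  centered_maximal f \in Defs.bounded_variation.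
Proof.
move=> fBV; set B := `|lim_ninfty f| + fine (Var f).
have fB n : `|f n| <= B by exact: normr_le_BV.
set V := fine (Var f).
have fV : (Var f <= V%:E)%E.
  by move/asboolP: (fBV) => h; rewrite fineK// ge0_fin_numE ?Var_ge0.
have part_V m : partial_var f m <= V by exact: partial_var_le.
have outer_V m : (0 <= m)%N -> outer_var f 0 m <= V.
  move=> m0; apply: le_trans (part_V m); rewrite (partial_var_split f m0).
  by rewrite lerDr partial_var_ge0.
have GB i j : `|centered_maximal f i - centered_maximal f j| <= 2 * B.
  apply: (le_trans (ler_normB _ _)); rewrite mulr_natl mulr2n.
  by apply: lerD; exact: normr_maximal_le.
have [c Hc] : exists c, forall m, (1 <= m)%N -> outer_var (centered_maximal f) 1 m <= c.
  eexists => m m1.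
  by apply: (maximal_outer_var fB _ m1 outer_V part_V (o := 2 * B)).
apply/asboolP; apply: (@le_lt_trans _ _ (partial_var (centered_maximal f) 1 + c)%:E).
  apply: Var_le => -[|m].
    rewrite /partial_var muln0 big_geq// addr_ge0 ?partial_var_ge0//.
    exact: le_trans (outer_var_ge0 _ _ _) (Hc 1%N (leqnn _)).
  by rewrite (partial_var_split _ (ltn0Sn m)) lerD2l Hc.
exact: ltry.
Qed.

End BVTails.

(** * Continuity *)

Section Continuity.
Variable R : realType.

Lemma outer_var_triangle (f g h : int -> R) N m :
  (forall n, `|dderiv h n| <= `|dderiv f n| + `|dderiv g n|) ->
  outer_var h N m <= outer_var f N m + outer_var g N m.
Proof. by move=> le; rewrite /outer_var -big_split/=; apply: ler_sum. Qed.

Lemma dderivB_le (f g : int -> R) n :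
  `|dderiv (f - g) n| <= `|dderiv f n| + `|dderiv g n|.
Proof.
have -> : dderiv (f - g) n = dderiv f n - dderiv g n.
  by have E k : (f - g) k = f k - g k by []; rewrite /dderiv !E; ring.
exact: ler_normB.
Qed.

(** N makes the variation of f outside [-N, N) small, K makes the factor
2 N / (K - N) and the oscillation of Mf beyond K small, and dl makes the
supremum norm of Mf - Mh small against the number of points of [-K, K). *)
Lemma maximal_continuity_modulus (f : BV R) (eps : R) : 0 < eps ->
  exists2 dl, 0 < dl & forall h : BV R, `|f - h| < dl ->
    `|lim_ninfty (centered_maximal f - centered_maximal h)| +
      fine (Var (centered_maximal f - centered_maximal h)) <= eps.
Proof.
move=> eps0; set G := centered_maximal f.
have VarE (k : BV R) : Var k = (fine (Var k))%:E by rewrite fineK// Var_fin_num.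
have normE (k : BV R) n : `|k n| <= `|k|.
  by rewrite BV_normE; apply: normr_le_BV; exact: BV_prop.
pose V := fine (Var f).
pose C : R := 1 + 204 * 80.
have C0 : 0 < C by rewrite /C addr_gt0// mulr_gt0.
(* The limit at minus infinity costs e1 and the variation (20 + 12 C) e1: e1
   inside the window, e1 for the tail of Mf, the rest for the tail of Mh. *)
pose e1 := eps / (21 + 12 * C).
have D0 : 0 < 21 + 12 * C by rewrite addr_gt0// mulr_gt0.
have e10 : 0 < e1 by rewrite divr_gt0.
have [N HN] := outer_var_small (VarE f) e10.
have GBV : G \in Defs.bounded_variation by apply: maximal_bounded_variation; exact: BV_prop.
have [NG HNG] : exists N, forall m, (N <= m)%N -> outer_var G N m <= e1.
  apply: (@outer_var_small R G (fine (Var G))) => //.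
  by rewrite fineK// ge0_fin_numE ?Var_ge0//; move/asboolP: GBV.
have V0 : 0 <= V by rewrite fine_ge0// Var_ge0.
pose K := (NG + N + 1 + Num.truncn ((2 * N)%:R * (V + 1) / e1))%N.
have NK : (N < K)%N by rewrite /K; clear; lia.
have HK m : (K <= m)%N -> outer_var G K m <= e1.
  move=> Km; have NGK : (NG <= K <= m)%N by rewrite Km andbT /K; clear; lia.
  apply: (le_trans (outer_var_anti G NGK)); apply: HNG.
  by case/andP: NGK => /leq_trans; apply.
have small : (2 * N)%:R / (K - N)%:R * (V + 1) <= e1.
  rewrite mulrAC ler_pdivrMr ?ltr0n ?subn_gt0// -ler_pdivrMl// mulrC.
  apply: ltW; apply: lt_le_trans (truncnS_gt _) _.
  rewrite ler_nat /K; set t := Num.truncn _.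
  by clear; lia.
pose dl := Num.min 1 (e1 / (4 * K + 1)%:R).
have dl0 : 0 < dl by rewrite lt_min ltr01 divr_gt0// ltr0n addn1.
have dl1 : dl <= 1 by rewrite ge_min lexx.
have dlK : dl * (4 * K + 1)%:R <= e1.
  have p0 : 0 < (4 * K + 1)%:R :> R by rewrite ltr0n addn1.
  by rewrite -ler_pdivlMr// /dl ge_min lexx orbT.
have dle : dl <= e1.
  by apply: le_trans dlK; apply: ler_peMr; rewrite ?ler1n ?addn1// ltW.
exists dl => // h fh.
set H := centered_maximal h.
have fhB n : `|f n - h n| <= dl.
  by apply: le_trans (ltW fh); have := normE (f - h) n.
have Vfh : (Var (BV_fun (f - h)%R) <= dl%:E)%E.
  rewrite VarE lee_fin; apply: le_trans (ltW fh).
  by rewrite BV_normE lerDr.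
have GH n : `|G n - H n| <= dl.
  exact: (maximal_dist_le n (normE f) (normE h) fhB).
have dh n : `|dderiv h n| <= `|dderiv f n| + `|dderiv (f - h) n|.
  have -> : dderiv h n = dderiv f n - dderiv (f - h) n.
    by have E k : (f - h) k = f k - h k by []; rewrite /dderiv !E; ring.
  exact: ler_normB.
have part_fh m : partial_var (f - h) m <= dl by exact: partial_var_le.
have outer_h m : (N <= m)%N -> outer_var h N m <= 2 * e1.
  move=> Nm; apply: (le_trans (outer_var_triangle N m dh)).
  rewrite mulr_natl mulr2n; apply: lerD; first exact: HN.
  apply: le_trans dle; apply: le_trans (part_fh m).
  by rewrite (partial_var_split _ Nm) lerDr partial_var_ge0.
have part_h m : partial_var h m <= V + 1.
  apply: (@le_trans _ _ (partial_var f m + partial_var (f - h) m)).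
    by rewrite /partial_var -big_split/=; apply: ler_sum.
  apply: lerD; first by apply: partial_var_le; rewrite VarE.
  exact: le_trans (part_fh m) dl1.
have oscH i : (K <= i)%N -> `|H i%:Z - H K%:Z| <= 3 * e1 /\
    `|H (- i%:Z) - H (- K%:Z)| <= 3 * e1.
  move=> Ki; have [A1 A2] := dist_le_outer_var G Ki; have A3 := HK i Ki.
  have key a b : `|G a - G b| <= outer_var G K i -> `|H a - H b| <= 3 * e1.
    move=> Gab; have -> : H a - H b = (G a - G b) - (G a - H a) + (G b - H b) by ring.
    apply: (le_trans (ler_normD _ _)); have := ler_normB (G a - G b) (G a - H a).
    have := GH a; have := GH b; move: Gab A3 dle; lra.
  by split; apply: key.
have outerH m : (K <= m)%N -> outer_var H K m <= (18 + 12 * C) * e1.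
  move=> Km; apply: (le_trans (maximal_outer_var (normE h) NK Km outer_h part_h oscH)).
  rewrite -/C; move: small; set q := _ / _ * _ => small.
  have := ler_wpM2l (ltW C0) small; lra.
have partGH m : partial_var (G - H) m <= (20 + 12 * C) * e1.
  wlog Km : m / (K <= m)%N => [W|].
    have [/W//|/ltnW mK] := leqP K m.
    by apply: le_trans (W K (leqnn _)); exact: partial_var_mono.
  rewrite (partial_var_split _ Km).
  have A : partial_var (G - H) K <= e1.
    apply: le_trans dlK; rewrite /partial_var.
    apply: (@le_trans _ _ (\sum_(0 <= i < 2 * K) (2 * dl))).
      apply: ler_sum => i _; move: (i%:Z - K%:Z) => n.
      have -> : dderiv (G - H) n = (G (n + 1) - H (n + 1)) - (G n - H n) by [].
      apply: (le_trans (ler_normB _ _)).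
      by rewrite [leRHS]mulr_natl mulr2n lerD.
    rewrite sumr_const_nat subn0 -mulr_natr natrD !natrM.
    move: dl0; clear.
    have K0 : 0 <= K%:R :> R by [].
    nra.
  have B := outer_var_triangle K m (dderivB_le G H).
  have := HK m Km; have := outerH m Km; lra.
have GHBV : G - H \in Defs.bounded_variation.
  by apply/asboolP; apply: le_lt_trans (Var_le partGH) (ltry _).
have L : `|lim_ninfty (G - H)| <= dl by apply: lim_ninfty_le.
have VGH : fine (Var (G - H)) <= (20 + 12 * C) * e1.
  rewrite -lee_fin fineK; first exact: Var_le.
  by move/asboolP: GHBV => ?; rewrite ge0_fin_numE ?Var_ge0.
apply: (le_trans (lerD L VGH)).
have -> : eps = (21 + 12 * C) * e1 by rewrite /e1 mulrC divfK// gt_eqF.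
by move: dle; lra.
Qed.

End Continuity.

Unset Implicit Arguments.
Set Strict Implicit.

Theorem theorem1p2 (R : realType) :
  exists M : BV R -> BV R,
    (forall (f : BV R) (n : int), M f n = centered_maximal f n) /\
    continuous M.
Proof.
exists (fun f => MkBV (maximal_bounded_variation (BV_prop f))); split=> // f.
apply: (proj2 (@cvgrPdist_le _ _ _ _ (nbhs_filter f) _ _)) => eps eps0.
have [dl dl0 Hdl] := maximal_continuity_modulus f eps0.
have := @cvgr_dist_lt _ _ _ _ (nbhs_filter f) id f (@cvg_id _ _) dl dl0.
apply: (@filterS _ _ (nbhs_filter f)) => h fh; rewrite BV_normE; exact: Hdl.
Qed.
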